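(* Let $M$ be a connected smooth manifold whose fundamental group $\pi_1(M)$ is nilpotent. Then for any closed $1$-form $\theta$ on $M$ with non-trivial de Rham cohomology class $[\theta]\in H^1_{\mathrm{dR}}(M)$, we have $H^1_{\theta}(M)=0$.
   Context: For a closed $1$-form $\theta$ on $M$, the twisted differential is $d_\theta:=d-\theta\wedge\colon\Omega^k(M)\to\Omega^{k+1}(M)$; it satisfies $d_\theta\circ d_\theta=0$, and the twisted cohomology groups are $H^k_\theta(M):=\ker(d_\theta|_{\Omega^k(M)})/d_\theta(\Omega^{k-1}(M))$. These groups depend, up to isomorphism, only on the de Rham class of $\theta$. *)

(* Defs.v *)
From HB Require Import structures.
From mathcomp Require Import all_boot all_order all_algebra generic_quotient.
From mathcomp Require Import all_classical all_reals all_analysis.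
From mathcomp Require Import lra.

Set Implicit Arguments.
Unset Strict Implicit.
Unset Printing Implicit Defensive.

Import Order.TTheory GRing.Theory Num.Theory.
Import numFieldNormedType.Exports.

Local Open Scope classical_set_scope.
Local Open Scope ring_scope.

Section nilpotent.
Local Open Scope group_scope.
Variable G : groupType.

Definition is_subgroup (S : set G) : Prop :=
  [/\ S 1, forall x y, S x -> S y -> S (x * y) & forall x, S x -> S x^-1].

Definition generated (A : set G) : set G := smallest is_subgroup A.

Fixpoint lower_central (c : nat) : set G :=
  if c is c'.+1
  then generated [set z | exists x y, lower_central c' x /\ z = commg x y]
  else setT.

Definition nilpotent_group : Prop := exists c, lower_central c = [set 1].

End nilpotent.

Section gluing.
Variable R : realType.

Lemma within_continuous_comp (S T U : topologicalType) (A : set S) (B : set T)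
    (f : S -> T) (g : T -> U) :
  {within B, continuous g} -> (forall x, A x -> B (f x)) ->
  {within A, continuous f} ->
  {within A, continuous (fun x => g (f x))}.
Proof.
move=> /subspace_continuousP cg AB /subspace_continuousP cf.
apply/subspace_continuousP => x Ax.
move=> W /(cg _ (AB _ Ax)); rewrite /nbhs /= /within /= => Wg.
have := cf _ Ax _ Wg; rewrite /nbhs /= /within /= => Wf.
by near=> y => Ay; apply: (near Wf y) => //; exact: AB.
Unshelve. all: by end_near. Qed.

Lemma within_continuous_glue (S T : topologicalType) (W : set S) (c : S -> R)
    (f g : S -> T) : closed W -> continuous c ->
  {within W `&` [set x | c x <= 2^-1], continuous f} ->
  {within W `&` [set x | 2^-1 <= c x], continuous g} ->
  (forall x, W x -> c x = 2^-1 -> f x = g x) ->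
  {within W, continuous (fun x => if c x <= 2^-1 then f x else g x)}.
Proof.
move=> cW cc cf cg fg.
set A := [set x | c x <= 2^-1]; set B := [set x | 2^-1 <= c x].
have cA : closed A.
  by apply: (@preimage_closed _ _ c [set y | y <= 2^-1]); [move=> x _; exact: cc|exact: closed_le].
have cB : closed B.
  by apply: (@preimage_closed _ _ c [set y | 2^-1 <= y]); [move=> x _; exact: cc|exact: closed_ge].
apply: (@continuous_subspaceW _ _ _ ((W `&` A) `|` (W `&` B))).
  move=> x Wx; have [h|/ltW h] := leP (c x) 2^-1; [left|right]; exact: conj.
apply: withinU_continuous; [exact: closedI|exact: closedI| |].
- by apply: subspace_eq_continuous cf => x; rewrite inE /from_subspace => -[_ /= h]; rewrite h.
- apply: subspace_eq_continuous cg => x; rewrite inE /from_subspace => -[Wx /= h] /=.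
  by case: ifPn => // h'; rewrite fg //; apply/eqP; rewrite eq_le h h'.
Qed.

End gluing.

Section fundamental_group.
Variables (R : realType) (M : topologicalType) (p : M).

Definition unit_interval : set R := [set t | 0 <= t <= 1].
Local Notation I := unit_interval.

Lemma closed_unit_interval : closed I.
Proof.
have -> : I = `[0, 1]%classic by apply/seteqP; split => t; rewrite /= in_itv.
exact: itv_closed.
Qed.

(* only the values of a loop on [0, 1] are meaningful *)
Record loop := Loop {
  loop_fun :> R -> M;
  loop_continuous : {within I, continuous loop_fun};
  loop0 : loop_fun 0 = p;
  loop1 : loop_fun 1 = p }.
Arguments loop_continuous : clear implicits.

HB.instance Definition _ := gen_eqMixin loop.
HB.instance Definition _ := gen_choiceMixin loop.

(* first coordinate: time of the homotopy; second: parameter of the loop *)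
Definition homotopic (f g : loop) : Prop := exists H : R * R -> M,
  [/\ {within I `*` I, continuous H},
      forall t, I t -> H (0, t) = f t,
      forall t, I t -> H (1, t) = g t &
      forall s, I s -> H (s, 0) = p /\ H (s, 1) = p].

Lemma closed_square : closed (I `*` I).
Proof.
have -> : I `*` I = (fst @^-1` I) `&` (snd @^-1` I) by [].
by apply: closedI; apply: preimage_closed closed_unit_interval => x _;
  [exact: cvg_fst|exact: cvg_snd].
Qed.


Lemma pair_continuous (S : topologicalType) (f g : S -> R) :
  continuous f -> continuous g -> continuous (fun x => (f x, g x)).
Proof. by move=> cf cg x; apply: (cvg_pair (cf x) (cg x)). Qed.

Lemma homotopic_reparam (f g h : loop) (a b : R -> R) :
  (forall t, I t -> I (a t)) -> (forall t, I t -> I (b t)) ->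
  continuous a -> continuous b -> a 0 = b 0 -> a 1 = b 1 ->
  (forall t, I t -> g t = f (a t)) -> (forall t, I t -> h t = f (b t)) ->
  homotopic g h.
Proof.
move=> aI bI ca cb ab0 ab1 gE hE.
have I0 : I 0 by rewrite /unit_interval /=; lra.
have I1 : I 1 by rewrite /unit_interval /=; lra.
exists (fun x => f ((1 - x.1) * a x.2 + x.1 * b x.2)); split => /=.
- refine (within_continuous_comp
    (f := fun x : R * R => (1 - x.1) * a x.2 + x.1 * b x.2) (loop_continuous f) _ _).
    move=> -[s t] [/= /andP[s0 s1] /= tI].
    have /andP[a0 a1] := aI _ tI; have /andP[b0 b1] := bI _ tI.
    by rewrite /unit_interval /=; apply/andP; split; nra.
  apply: continuous_subspaceT => x.
  have ca' : {for x, continuous (fun y : R * R => a y.2)}.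
    by apply: (@continuous_comp _ _ _ snd a); [exact: cvg_snd|exact: ca].
  have cb' : {for x, continuous (fun y : R * R => b y.2)}.
    by apply: (@continuous_comp _ _ _ snd b); [exact: cvg_snd|exact: cb].
  apply: cvgD; apply: cvgM; [|exact: ca'|exact: cvg_fst|exact: cb'].
  by apply: cvgB; [exact: cvg_cst|exact: cvg_fst].
- by move=> t It; rewrite subr0 mul1r mul0r addr0 gE.
- by move=> t It; rewrite subrr mul1r mul0r add0r hE.
- move=> s _; rewrite -ab0 -ab1 -!mulrDl subrK !mul1r -gE// -gE//.
  by rewrite loop0 loop1.
Qed.

Lemma homotopic_eq (f g : loop) : (forall t, I t -> f t = g t) -> homotopic f g.
Proof.
move=> fg; apply: (@homotopic_reparam f f g id id) => //.
- by move=> t; exact: cvg_id.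
- by move=> t; exact: cvg_id.
- by move=> t /fg.
Qed.

Lemma homotopic_refl f : homotopic f f. Proof. exact: homotopic_eq. Qed.

Lemma homotopic_sym f g : homotopic f g -> homotopic g f.
Proof.
move=> [H [cH H0 H1 HI]]; exists (fun x => H (1 - x.1, x.2)); split => /=.
- refine (within_continuous_comp (f := fun x : R * R => (1 - x.1, x.2)) cH _ _).
    by move=> -[s t] [/= /andP[? ?] ?]; split => //=; apply/andP; split; lra.
  apply: continuous_subspaceT; apply: pair_continuous => x; last exact: cvg_snd.
  by apply: cvgB; [exact: cvg_cst|exact: cvg_fst].
- by move=> t It; rewrite subr0 H1.
- by move=> t It; rewrite subrr H0.
- by move=> s /andP[? ?]; apply: HI; apply/andP; split; lra.
Qed.

Lemma homotopic_trans f g h : homotopic f g -> homotopic g h -> homotopic f h.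
Proof.
move=> [H [cH H0 H1 HI]] [K [cK K0 K1 KI]].
exists (fun x => if x.1 <= 2^-1 then H (2 * x.1, x.2) else K (2 * x.1 - 1, x.2)).
split => /=.
- apply: (@within_continuous_glue _ _ _ _ fst (fun x => H (2 * x.1, x.2))
    (fun x => K (2 * x.1 - 1, x.2))).
  + exact: closed_square.
  + by move=> x; exact: cvg_fst.
  + refine (within_continuous_comp (f := fun x : R * R => (2 * x.1, x.2)) cH _ _).
      move=> -[s t] [[/= /andP[? ?] ?] /= ?]; split => //=.
      by apply/andP; split; lra.
    apply: continuous_subspaceT; apply: pair_continuous => x; last exact: cvg_snd.
    by apply: cvgM; [exact: cvg_cst|exact: cvg_fst].
  + refine (within_continuous_comp (f := fun x : R * R => (2 * x.1 - 1, x.2)) cK _ _).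
      move=> -[s t] [[/= /andP[? ?] ?] /= ?]; split => //=.
      by apply/andP; split; lra.
    apply: continuous_subspaceT; apply: pair_continuous => x; last exact: cvg_snd.
    apply: cvgB; last exact: cvg_cst.
    by apply: cvgM; [exact: cvg_cst|exact: cvg_fst].
  + move=> -[s t] [/= _ It] ->; rewrite mulfV// subrr.
    by rewrite H1// K0.
- by move=> t It; rewrite mulr0 invr_ge0 ler0n H0.
- move=> t It; rewrite ifF; last by apply/negbTE; rewrite -ltNge; lra.
  by have -> : 2 * 1 - 1 = 1 :> R by [lra]; rewrite K1.
- move=> s /andP[? ?]; case: ifPn => hs.
    by apply: HI; apply/andP; split; lra.
  by apply: KI; move: hs; rewrite -ltNge => ?; apply/andP; split; lra.
Qed.

Definition concat_fun (f g : R -> M) (t : R) : M :=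
  if t <= 2^-1 then f (2 * t) else g (2 * t - 1).

Lemma concat_continuous (f g : loop) : {within I, continuous (concat_fun f g)}.
Proof.
apply: (@within_continuous_glue _ _ _ _ id (fun t => f (2 * t))
    (fun t => g (2 * t - 1))).
- exact: closed_unit_interval.
- by move=> x; exact: cvg_id.
- refine (within_continuous_comp (f := fun t : R => 2 * t) (loop_continuous f) _ _).
    by move=> t [/andP[? ?] /= ?]; apply/andP; split; lra.
  apply: continuous_subspaceT => x.
  by apply: cvgM; [exact: cvg_cst|exact: cvg_id].
- refine (within_continuous_comp (f := fun t : R => 2 * t - 1) (loop_continuous g) _ _).
    by move=> t [/andP[? ?] /= ?]; apply/andP; split; lra.
  apply: continuous_subspaceT => x.
  apply: cvgB; last exact: cvg_cst.
  by apply: cvgM; [exact: cvg_cst|exact: cvg_id].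
- by move=> x _ ->; rewrite mulfV// subrr loop0 loop1.
Qed.

Arguments concat_continuous : clear implicits.

Lemma concat0 (f g : loop) : concat_fun f g 0 = p.
Proof. by rewrite /concat_fun invr_ge0 ler0n mulr0 loop0. Qed.

Lemma concat1 (f g : loop) : concat_fun f g 1 = p.
Proof.
rewrite /concat_fun ifF; last by apply/negbTE; rewrite -ltNge; lra.
by have -> : 2 * 1 - 1 = 1 :> R by [lra]; rewrite loop1.
Qed.

Definition concat (f g : loop) : loop :=
  Loop (concat_continuous f g) (concat0 f g) (concat1 f g).

Lemma const_continuous : {within I, continuous (fun=> p)}.
Proof. by apply: continuous_subspaceT => x; exact: cvg_cst. Qed.

Definition const_loop : loop := Loop const_continuous erefl erefl.

Lemma reverse_continuous (f : loop) :
  {within I, continuous (fun t => f (1 - t))}.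
Proof.
refine (within_continuous_comp (f := fun t : R => 1 - t) (loop_continuous f) _ _).
  by move=> t /andP[? ?]; apply/andP; split; lra.
apply: continuous_subspaceT => x.
by apply: cvgB; [exact: cvg_cst|exact: cvg_id].
Qed.

Arguments reverse_continuous : clear implicits.

Lemma reverse0 (f : loop) : f (1 - 0) = p.
Proof. by rewrite subr0 loop1. Qed.

Lemma reverse1 (f : loop) : f (1 - 1) = p.
Proof. by rewrite subrr loop0. Qed.

Definition reverse (f : loop) : loop :=
  Loop (reverse_continuous f) (reverse0 f) (reverse1 f).

Lemma homotopic_concat f f' g g' :
  homotopic f f' -> homotopic g g' -> homotopic (concat f g) (concat f' g').
Proof.
move=> [H [cH H0 H1 HI]] [K [cK K0 K1 KI]].
exists (fun x => if x.2 <= 2^-1 then H (x.1, 2 * x.2) else K (x.1, 2 * x.2 - 1)).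
split => /=.
- apply: (@within_continuous_glue _ _ _ _ snd (fun x => H (x.1, 2 * x.2))
    (fun x => K (x.1, 2 * x.2 - 1))).
  + exact: closed_square.
  + by move=> x; exact: cvg_snd.
  + refine (within_continuous_comp (f := fun x : R * R => (x.1, 2 * x.2)) cH _ _).
      move=> -[s t] [[/= ? /andP[? ?]] /= ?]; split => //=.
      by apply/andP; split; lra.
    apply: continuous_subspaceT; apply: pair_continuous => x; first exact: cvg_fst.
    by apply: cvgM; [exact: cvg_cst|exact: cvg_snd].
  + refine (within_continuous_comp (f := fun x : R * R => (x.1, 2 * x.2 - 1)) cK _ _).
      move=> -[s t] [[/= ? /andP[? ?]] /= ?]; split => //=.
      by apply/andP; split; lra.
    apply: continuous_subspaceT; apply: pair_continuous => x; first exact: cvg_fst.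
    apply: cvgB; last exact: cvg_cst.
    by apply: cvgM; [exact: cvg_cst|exact: cvg_snd].
  + move=> -[s t] [/= Is _] ->; rewrite mulfV// subrr.
    by rewrite (HI _ Is).2 (KI _ Is).1.
- move=> t /andP[? ?]; rewrite /concat_fun; case: ifPn => ht.
    by rewrite H0//; apply/andP; split; lra.
  by rewrite K0//; move: ht; rewrite -ltNge => ?; apply/andP; split; lra.
- move=> t /andP[? ?]; rewrite /concat_fun; case: ifPn => ht.
    by rewrite H1//; apply/andP; split; lra.
  by rewrite K1//; move: ht; rewrite -ltNge => ?; apply/andP; split; lra.
- move=> s Is; rewrite invr_ge0 ler0n mulr0 (HI _ Is).1; split => //.
  rewrite ifF; last by apply/negbTE; rewrite -ltNge; lra.
  by have -> : 2 * 1 - 1 = 1 :> R by [lra]; rewrite (KI _ Is).2.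
Qed.

Lemma homotopic_reverse f g : homotopic f g -> homotopic (reverse f) (reverse g).
Proof.
move=> [H [cH H0 H1 HI]]; exists (fun x => H (x.1, 1 - x.2)); split => /=.
- refine (within_continuous_comp (f := fun x : R * R => (x.1, 1 - x.2)) cH _ _).
    by move=> -[s t] [/= ? /andP[? ?]]; split => //=; apply/andP; split; lra.
  apply: continuous_subspaceT; apply: pair_continuous => x; first exact: cvg_fst.
  by apply: cvgB; [exact: cvg_cst|exact: cvg_snd].
- by move=> t /andP[? ?]; rewrite H0//; apply/andP; split; lra.
- by move=> t /andP[? ?]; rewrite H1//; apply/andP; split; lra.
- by move=> s Is; rewrite subr0 subrr; have [] := HI _ Is.
Qed.

Lemma affine_continuous (a b : R) : continuous (fun t : R => a * t + b).
Proof.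
move=> x; apply: cvgD; last exact: cvg_cst.
by apply: cvgM; [exact: cvg_cst|exact: cvg_id].
Qed.

Lemma min_continuous (f g : R -> R) :
  continuous f -> continuous g -> continuous (fun t => Num.min (f t) (g t)).
Proof. by move=> cf cg x; exact: (continuous_min (cf x) (cg x)). Qed.

Lemma max_continuous (f g : R -> R) :
  continuous f -> continuous g -> continuous (fun t => Num.max (f t) (g t)).
Proof. by move=> cf cg x; exact: (continuous_max (cf x) (cg x)). Qed.

Ltac split_le := repeat match goal with
  | |- context [Order.min ?a ?b] =>
      lazymatch b with context [Order.min _ _] => fail | _ => case: (leP a b) => ? end
  | |- context [Order.max ?a ?b] => case: (leP a b) => ?
  | |- context [if ?a <= ?b then _ else _] => case: (leP a b) => ?
  end.
Ltac reparam_le := move=> t /andP[? ?] /=; rewrite /unit_interval /=; split_le;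
  apply/andP; split; lra.
Ltac reparam_eq := split_le; first [exfalso; lra | congr (loop_fun _ _); lra].

Lemma homotopic_concatA f g h :
  homotopic (concat f (concat g h)) (concat (concat f g) h).
Proof.
pose phi (t : R) : R :=
  Num.min (2 * t + 0) (Num.min (1 * t + 4^-1) (2^-1 * t + 2^-1)).
apply: (@homotopic_reparam (concat f (concat g h)) _ _ id phi) => //.
- by rewrite /phi; reparam_le.
- by move=> x; exact: cvg_id.
- apply: min_continuous; first exact: affine_continuous.
  by apply: min_continuous; exact: affine_continuous.
- by rewrite /phi; split_le; lra.
- by rewrite /phi; split_le; lra.
- move=> t /andP[? ?] /=; rewrite /concat_fun /= /concat_fun /phi.
  by reparam_eq.
Qed.

Lemma homotopic_concat1 f : homotopic (concat f const_loop) f.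
Proof.
apply: (@homotopic_reparam f _ _ (fun t => Num.min (2 * t + 0) 1) id) => //.
- by reparam_le.
- by apply: min_continuous; [exact: affine_continuous|by move=> x; exact: cvg_cst].
- by move=> x; exact: cvg_id.
- by split_le; lra.
- by split_le; lra.
- move=> t /andP[? ?] /=; rewrite /concat_fun /= -(loop1 f).
  by reparam_eq.
Qed.

Lemma homotopic_1concat f : homotopic (concat const_loop f) f.
Proof.
apply: (@homotopic_reparam f _ _ (fun t => Num.max (2 * t + (- 1)) 0) id) => //.
- by reparam_le.
- by apply: max_continuous; [exact: affine_continuous|by move=> x; exact: cvg_cst].
- by move=> x; exact: cvg_id.
- by split_le; lra.
- by split_le; lra.
- move=> t /andP[? ?] /=; rewrite /concat_fun /= -(loop0 f).
  by reparam_eq.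
Qed.

Lemma homotopic_concatV f : homotopic (concat f (reverse f)) const_loop.
Proof.
apply: (@homotopic_reparam f _ _ (fun t => Num.min (2 * t + 0) (- 2 * t + 2))
  (fun=> 0)) => //.
- by reparam_le.
- by move=> t _; apply/andP; split; lra.
- by apply: min_continuous; exact: affine_continuous.
- by move=> x; exact: cvg_cst.
- by split_le; lra.
- by split_le; lra.
- move=> t /andP[? ?] /=; rewrite /concat_fun /=.
  by reparam_eq.
- by move=> t _ /=; rewrite loop0.
Qed.

Lemma homotopic_Vconcat f : homotopic (concat (reverse f) f) const_loop.
Proof.
apply: (@homotopic_reparam f _ _ (fun t => Num.max (- 2 * t + 1) (2 * t + (- 1)))
  (fun=> 1)) => //.
- by reparam_le.
- by move=> t _; apply/andP; split; lra.
- by apply: max_continuous; exact: affine_continuous.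
- by move=> x; exact: cvg_cst.
- by split_le; lra.
- by split_le; lra.
- move=> t /andP[? ?] /=; rewrite /concat_fun /=.
  by reparam_eq.
- by move=> t _ /=; rewrite loop1.
Qed.

Definition homotopic_rel : rel loop := fun f g => `[< homotopic f g >].

Lemma homotopic_rel_refl : reflexive homotopic_rel.
Proof. by move=> f; apply/asboolP; exact: homotopic_refl. Qed.

Lemma homotopic_rel_sym : symmetric homotopic_rel.
Proof. by move=> f g; apply/asboolP/asboolP; exact: homotopic_sym. Qed.

Lemma homotopic_rel_trans : transitive homotopic_rel.
Proof.
by move=> g f h /asboolP fg /asboolP gh; apply/asboolP; exact: homotopic_trans gh.
Qed.

Definition homotopic_equiv := EquivRel homotopic_rel
  homotopic_rel_refl homotopic_rel_sym homotopic_rel_trans.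

Definition pi1 := {eq_quot homotopic_equiv}%qT.
HB.instance Definition _ := Choice.on pi1.

Definition pi1_class (f : loop) : pi1 := (\pi_pi1 f)%qT.
Definition pi1_one : pi1 := pi1_class const_loop.
Definition pi1_mul (x y : pi1) : pi1 :=
  pi1_class (concat (repr x) (repr y)).
Definition pi1_inv (x : pi1) : pi1 := pi1_class (reverse (repr x)).

Lemma pi1_classP (f g : loop) : pi1_class f = pi1_class g <-> homotopic f g.
Proof.
split; first by move=> /eqmodP /asboolP.
by move=> fg; apply/eqmodP/asboolP.
Qed.

Lemma repr_pi1_class f : homotopic (repr (pi1_class f)) f.
Proof. by apply/pi1_classP; rewrite /pi1_class reprK. Qed.

Lemma pi1_classM f g : pi1_mul (pi1_class f) (pi1_class g) = pi1_class (concat f g).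
Proof.
by apply/pi1_classP; apply: homotopic_concat; exact: repr_pi1_class.
Qed.

Lemma pi1_classV f : pi1_inv (pi1_class f) = pi1_class (reverse f).
Proof. by apply/pi1_classP; apply: homotopic_reverse; exact: repr_pi1_class. Qed.

Lemma pi1_classW (P : pi1 -> Prop) : (forall f, P (pi1_class f)) -> forall x, P x.
Proof. by move=> Pf x; rewrite -(reprK x); exact: Pf. Qed.

Lemma pi1_mulA : associative pi1_mul.
Proof.
elim/pi1_classW => f; elim/pi1_classW => g; elim/pi1_classW => h.
by rewrite !pi1_classM; apply/pi1_classP; exact: homotopic_concatA.
Qed.

Lemma pi1_mul1 : left_id pi1_one pi1_mul.
Proof.
elim/pi1_classW => f.
by rewrite pi1_classM; apply/pi1_classP; exact: homotopic_1concat.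
Qed.

Lemma pi1_mulr1 : right_id pi1_one pi1_mul.
Proof.
elim/pi1_classW => f.
by rewrite pi1_classM; apply/pi1_classP; exact: homotopic_concat1.
Qed.

Lemma pi1_mulV : left_inverse pi1_one pi1_inv pi1_mul.
Proof.
elim/pi1_classW => f.
by rewrite pi1_classV pi1_classM; apply/pi1_classP; exact: homotopic_Vconcat.
Qed.

Lemma pi1_mulrV : right_inverse pi1_one pi1_inv pi1_mul.
Proof.
elim/pi1_classW => f.
by rewrite pi1_classV pi1_classM; apply/pi1_classP; exact: homotopic_concatV.
Qed.

HB.instance Definition _ :=
  isGroup.Build pi1 pi1_mulA pi1_mul1 pi1_mulr1 pi1_mulV pi1_mulrV.

End fundamental_group.
Arguments pi1 R {M} p.

Fixpoint Ck_on (R : realType) (V W : normedModType R) (m : nat) (U : set V)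
    (f : V -> W) : Prop :=
  {within U, continuous f} /\
  if m is m'.+1
  then forall v, (forall x, U x -> derivable f x v) /\ Ck_on m' U ('D_v f)
  else True.

(* meant for open sets U *)
Definition smooth_on (R : realType) (V W : normedModType R) (U : set V)
  (f : V -> W) : Prop := forall m, Ck_on m U f.

(* a homeomorphism from an open set of M onto an open set of R^n; [chart_fun]
   and [chart_inv] are total functions with arbitrary values outside of them *)
Record chart (R : realType) (M : topologicalType) (n : nat) := Chart {
  chart_dom : set M;
  chart_fun :> M -> 'rV[R]_n;
  chart_inv : 'rV[R]_n -> M;
  chart_dom_open : open chart_dom;
  chart_img_open : open (chart_fun @` chart_dom);
  chart_funK : forall x, chart_dom x -> chart_inv (chart_fun x) = x;
  chart_fun_continuous : {within chart_dom, continuous chart_fun};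
  chart_inv_continuous : {within chart_fun @` chart_dom, continuous chart_inv} }.

Definition transition (R : realType) (M : topologicalType) (n : nat)
  (a b : chart R M n) : 'rV[R]_n -> 'rV[R]_n := fun x => b (chart_inv a x).

Record smoothManifold (R : realType) := SmoothManifold {
  manifold_sort :> topologicalType;
  manifold_hausdorff : hausdorff_space manifold_sort;
  manifold_second_countable : @second_countable manifold_sort;
  manifold_dim : nat;
  atlas_index : Type;
  atlas : atlas_index -> chart R manifold_sort manifold_dim;
  atlas_cover : forall x, exists i, chart_dom (atlas i) x;
  atlas_smooth : forall i j,
    smooth_on (atlas i @` (chart_dom (atlas i) `&` chart_dom (atlas j)))
      (transition (atlas i) (atlas j)) }.

Section forms.
Variables (R : realType) (M : smoothManifold R).
Local Notation dim := (manifold_dim M).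
Local Notation chart_at := (atlas (s := M)).

(* [w i x v] is the value of the form at the point x on the tangent vectors
   whose coordinates in the chart of index i are v 0, ..., v (k - 1) *)
Definition preform (k : nat) : Type :=
  atlas_index M -> M -> ('I_k -> 'rV[R]_dim) -> R.

HB.instance Definition _ k := GRing.Zmodule.copy (preform k)
  (atlas_index M -> M -> ('I_k -> 'rV[R]_dim) -> R).

Definition multilinear k (w : ('I_k -> 'rV[R]_dim) -> R) : Prop :=
  forall v j, scalar (fun u => w [eta v with j |-> u]).

Definition alternating k (w : ('I_k -> 'rV[R]_dim) -> R) : Prop :=
  forall v a b, a != b -> v a = v b -> w v = 0.

Definition change_coord (i j : atlas_index M) (x : M) (u : 'rV[R]_dim) :
    'rV[R]_dim :=
  'D_u (transition (chart_at i) (chart_at j)) (chart_at i x).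

(* Omega^k(M); forms are set to 0 outside of the domains of the charts so that
   two forms are equal if and only if they have the same local expressions *)
Record Omega k (w : preform k) : Prop := {
  Omega_out : forall i x v, ~ chart_dom (chart_at i) x -> w i x v = 0;
  Omega_multilinear : forall i x, chart_dom (chart_at i) x ->
    multilinear (w i x);
  Omega_alternating : forall i x, chart_dom (chart_at i) x ->
    alternating (w i x);
  Omega_compatible : forall i j x v,
    chart_dom (chart_at i) x -> chart_dom (chart_at j) x ->
    w i x v = w j x (fun l => change_coord i j x (v l));
  Omega_smooth : forall i v,
    smooth_on (chart_at i @` chart_dom (chart_at i))
      (fun y => w i (chart_inv (chart_at i) y) v : R) }.

Definition ext_d k (w : preform k) : preform k.+1 := fun i x v =>
  if `[< chart_dom (chart_at i) x >] then
    \sum_(j < k.+1) (-1) ^+ j *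
      'D_(v j) (fun y => w i (chart_inv (chart_at i) y) (fun l => v (lift j l)) : R)
        (chart_at i x)
  else 0.

Definition wedge1 k (theta : preform 1) (w : preform k) : preform k.+1 :=
  fun i x v => \sum_(j < k.+1) (-1) ^+ j *
    (theta i x (fun=> v j) * w i x (fun l => v (lift j l))).

Definition twisted_d (theta : preform 1) k (w : preform k) : preform k.+1 :=
  ext_d w - wedge1 theta w.

Section cohomology.
Variable D : forall k, preform k -> preform k.+1.

Definition cocycles k : set (preform k) := [set w | Omega w /\ D w = 0].

Definition coboundaries k : set (preform k) :=
  match k with
  | 0 => [set 0]
  | k'.+1 => @D k' @` @Omega k'
  end.

Arguments cocycles k : clear implicits.
Arguments coboundaries k : clear implicits.

Definition cohomology_class k (w : preform k) : set (preform k) :=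
  [set w + b | b in coboundaries k].

Definition cohomology k : set (set (preform k)) :=
  @cohomology_class k @` cocycles k.

End cohomology.

Definition closed_form k (w : preform k) : Prop := cocycles (@ext_d) w.

Definition deRham_class k (w : preform k) : set (preform k) :=
  cohomology_class (@ext_d) w.

Definition twisted_cohomology (theta : preform 1) (k : nat) :
    set (set (preform k)) :=
  @cohomology (@twisted_d theta) k.

Definition twisted_class (theta : preform 1) k (w : preform k) :
    set (preform k) :=
  cohomology_class (@twisted_d theta) w.

End forms.
Arguments cocycles {R M} D k _.
Arguments coboundaries {R M} D k _.
Arguments cohomology {R M} D k _.
Arguments twisted_cohomology {R M} theta k _.

(* Main.v *)
(** The local solutions f of the twisted equation df = theta f + w form a
    locally constant sheaf of affine lines: on a ball, if dh = theta and
    dF = exp(-h) w (Poincare lemma), they are the functions exp(h) (F + c).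
    Continuation along loops therefore makes pi_1 act on the line by affine maps
    a |-> rho a + c, whose linear part is rho = exp(chi) with chi the period
    character of theta. If [theta] <> 0 then rho is not trivial, and a nilpotent
    group of affine maps of the line with non-trivial linear part has a fixed
    point. A fixed point continues to a global solution f, that is
    w = d_theta f. *)

Require Import Defs.
From HB Require Import structures.
From mathcomp Require Import all_boot all_order all_algebra.
From mathcomp Require Import all_classical all_reals all_analysis.
From mathcomp Require Import ring lra.

Set Implicit Arguments.
Unset Strict Implicit.
Unset Printing Implicit Defensive.

Import Order.TTheory GRing.Theory Num.Theory.
Import numFieldNormedType.Exports.

Local Open Scope classical_set_scope.
Local Open Scope ring_scope.

(** * Nilpotent groups of affine maps of the line *)

(** Loops are only continuous, so [theta] cannot be integrated along them. Periods, transport and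
    homotopy invariance are all obtained by continuing solutions over compact pieces of the line and
    the plane, where a Lebesgue number reduces everything to small cells. The equation
    [df = theta f + w] is treated once, for a general pair of forms, and used three times: with
    [(theta, w)] it gives the affine action, with [(theta, 0)] its linear part, and with
    [(0, theta)] the primitives of [theta], whose monodromy is the period character. Exponentiation
    carries the third system to the second. The exponential is injective on the reals, so a trivial
    linear part forces all periods to vanish and makes [theta] exact; this is how the hypothesis on
    the class of [theta] enters. On the analytic side, smoothness is expressed by iterated
    directional derivatives. These alone give neither continuity nor a chain rule; both are
    recovered from the mean value theorem and from the linearity and continuity of the derivative,
    and they are needed to compare charts and to prove that the solutions are smooth. *)

Section affine_action.
Variables (R : realFieldType) (G : groupType).

(* For [r g != 1] translate so that [g] fixes [a0]; then the displacement [b] of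
   [a0] satisfies [b [~ x, g] = (r g - 1) * b x], so a nonzero displacement
   would survive along the whole lower central series. *)
Lemma nilpotent_affine_fixpoint (r c : G -> R) (g : G) :
  (forall x y a, r (x * y)%g * a + c (x * y)%g = r y * (r x * a + c x) + c y) ->
  (forall a, r 1%g * a + c 1%g = a) ->
  nilpotent_group G -> r g != 1 -> exists a, forall x, r x * a + c x = a.
Proof.
move=> AM A1 [n nilp] rg1; pose A x a := r x * a + c x.
have {}AM x y a : A (x * y)%g a = A y (A x a) by exact: AM.
have {}A1 a : A 1%g a = a by exact: A1.
have AK x a : A (x^-1)%g (A x a) = a by rewrite -AM mulgV A1.
have AVK x a : A x (A (x^-1)%g a) = a by rewrite -AM mulVg A1.
have ABE x a b : A x a - A x b = r x * (a - b).
  by rewrite /A opprD addrACA subrr addr0 mulrBr.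
pose a0 := c g / (1 - r g).
have r1 : 1 - r g != 0 by rewrite subr_eq0 eq_sym.
have Ag0 : A g a0 = a0.
  apply/eqP; rewrite -subr_eq0 /A /a0; apply/eqP; field; exact: r1.
exists a0 => x; apply: contrapT => /eqP; rewrite -/(A x a0) -subr_eq0 => bx.
pose s := fix s k := if k is k'.+1 then commg (s k') g else x.
have sL k : lower_central k (s k).
  elim: k => [//|k IH] /=; apply: sub_gen_smallest.
  by exists (s k), g.
have rV y : r y * r (y^-1)%g = 1.
  by have := ABE y (A (y^-1)%g 1) (A (y^-1)%g 0); rewrite !AVK ABE !subr0 mulr1.
have bs k : A (s k) a0 - a0 != 0.
  elim: k => [//|k IH] /=; set y := s k in IH *.
  have -> : A (commg y g) a0 - a0 = (r g - 1) * (A y a0 - a0).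
    rewrite /commg /conjg !AM.
    set b := A y a0 - a0 in IH *.
    have -> : A (y^-1)%g a0 = a0 - r (y^-1)%g * b.
      by have := ABE (y^-1)%g (A y a0) a0; rewrite AK => <-; ring.
    set t := _ * b.
    have Vg0 : A (g^-1)%g a0 = a0 by rewrite -{1}Ag0 AK.
    have -> : A (g^-1)%g (a0 - t) = a0 - r (g^-1)%g * t.
      by have := ABE (g^-1)%g (a0 - t) a0; rewrite Vg0; lra.
    set t' := _ * t.
    have -> : A y (a0 - t') = a0 + b - r y * t'.
      by have := ABE y (a0 - t') a0; rewrite /b; lra.
    have -> : A g (a0 + b - r y * t') = a0 + r g * (b - r y * t').
      by have := ABE g (a0 + b - r y * t') a0; rewrite Ag0; lra.
    have -> : r y * t' = r (g^-1)%g * b.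
      by rewrite /t' /t mulrCA [r y * _]mulrA rV mul1r.
    by rewrite mulrBr mulrA rV; ring.
  by rewrite mulf_neq0// subr_eq0.
have := bs n; have := sL n; rewrite nilp => ->.
by rewrite A1 subrr eqxx.
Qed.

End affine_action.

(** * Continuation along maps in a locally constant sheaf *)

(** Local constancy relative to [A] makes the part of [A] where [P] holds both relatively open and
    relatively closed: it is cut out by the interior of [A y -> P y] and by the complement of the
    interior of [A y -> ~ P y]. *)
Lemma connected_locally_constant (T : topologicalType) (A : set T)
    (P : T -> Prop) : connected A ->
  (forall x, A x -> \forall y \near x, A y -> (P y <-> P x)) ->
  forall x y, A x -> A y -> P x -> P y.
Proof.
move=> cA locP x y Ax Ay Px; have PAx : (A `&` P) x by [].
suff BA : A `&` P = A by move: Ay; rewrite -BA => -[].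
apply: cA; first by exists x.
- exists (interior [set y | A y -> P y]); first exact: open_interior.
  apply/seteqP; split=> z [Az Pz]; split => //; last exact: (nbhs_singleton Pz).
  by apply: filterS (locP z Az) => w /[swap] /[dup] Aw _ /(_ Aw) [_]; apply.
- exists (~` interior [set y | A y -> ~ P y]).
    by apply: open_closedC; exact: open_interior.
  apply/seteqP; split=> z [Az Pz]; split => //.
    by move=> /nbhs_singleton /(_ Az).
  apply: contrapT => nPz; apply: Pz; apply: filterS (locP z Az) => w H Aw Pw.
  by apply: nPz; apply/(H Aw).
Qed.

Lemma within_near (T U : topologicalType) (K : set T) (s : T -> U) x (V : set U) :
  {within K, continuous s} -> K x -> open V -> V (s x) ->
  \forall y \near x, K y -> V (s y).
Proof.
move=> /subspace_continuousP cs Kx oV Vx.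
by have := cs x Kx V (open_nbhs_nbhs (conj oV Vx)).
Qed.

Section local_system.
Variables (R : realType) (M : topologicalType).
Variable sol : set M -> (M -> R) -> Prop.
Local Notation I := (@unit_interval R).

Definition path_in (U : set M) (x y : M) (c : R -> M) : Prop :=
  [/\ {within I, continuous c}, c 0 = x, c 1 = y & forall t, I t -> U (c t)].

Definition path_connected (U : set M) : Prop :=
  forall x y, U x -> U y -> exists c, path_in U x y c.

(* [sol] restricts to a constant sheaf with stalk R on U *)
Definition trivializing (U : set M) : Prop :=
  [/\ open U, path_connected U,
      forall y a, U y -> exists2 f, sol U f & f y = a &
      forall f g y z, sol U f -> sol U g -> U y -> U z -> f y = g y -> f z = g z].

Definition local_system : Prop :=
  (forall U V f, U `<=` V -> sol V f -> sol U f) /\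
  (forall x V, open V -> V x -> exists U, [/\ trivializing U, U x & U `<=` V]).

Definition continuation (T : topologicalType) (K : set T) (s : T -> M) (u : T -> R) :=
  forall x, K x -> exists U f, [/\ open U, U (s x), sol U f &
    \forall y \near x, K y -> u y = f (s y)].

Hypothesis Hsol : local_system.
Let sol_sub := Hsol.1.
Let basis := Hsol.2.

Lemma continuation_comp (T S : topologicalType) (K : set T) (L : set S) (s : T -> M) u
    (h : S -> T) : (forall x, L x -> K (h x)) -> continuous h ->
  continuation K s u -> continuation L (s \o h) (u \o h).
Proof.
move=> LK ch lu x Lx; have [U [f [oU Ux sf nf]]] := lu _ (LK _ Lx).
have nh : \forall y \near x, K (h y) -> u (h y) = f (s (h y)) := ch x _ nf.
by exists U, f; split => //; apply: filterS nh => y H Ly; exact: (H (LK _ Ly)).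
Qed.

Lemma continuation_subset (T : topologicalType) (K L : set T) (s : T -> M) u :
  L `<=` K -> continuation K s u -> continuation L s u.
Proof.
move=> LK lu x Lx; have [U [f [oU Ux sf nf]]] := lu _ (LK _ Lx).
by exists U, f; split => //; apply: filterS nf => y H Ly; exact: (H (LK _ Ly)).
Qed.

Lemma continuation_eq (T : topologicalType) (K : set T) (s s' : T -> M) u u' :
  (forall x, K x -> s x = s' x) -> (forall x, K x -> u x = u' x) ->
  continuation K s u -> continuation K s' u'.
Proof.
move=> ss uu lu x Kx; have [U [f [oU Ux sf nf]]] := lu _ Kx.
exists U, f; rewrite -ss//; split => //; apply: filterS nf => y H Ky.
by rewrite -ss// -uu//; exact: H.
Qed.

Lemma continuation_sol (T : topologicalType) (K : set T) (s : T -> M) U f :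
  open U -> sol U f -> (forall x, K x -> U (s x)) -> continuation K s (f \o s).
Proof.
by move=> oU sf KU x Kx; exists U, f; split => //; [exact: KU|exact: nearW].
Qed.

(** Near each point both continuations come from solutions on one trivializing set, where agreement
    at a point is agreement everywhere. So [u x = v x] is a locally constant condition on the
    connected set [K]. *)
Lemma continuation_unique (T : topologicalType) (K : set T) (s : T -> M) u v x y :
  connected K -> {within K, continuous s} -> continuation K s u -> continuation K s v ->
  K x -> K y -> u x = v x -> u y = v y.
Proof.
move=> cK cs lu lv.
move: x y; apply: (@connected_locally_constant _ K (fun x => u x = v x) cK).
move=> x Kx; have [U [f [oU Ux sf nf]]] := lu x Kx.
have [V [g [oV Vx sg ng]]] := lv x Kx.
have [W [[oW _ _ uW] Wx WUV]] := basis (openI oU oV) (conj Ux Vx).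
have sfW : sol W f by apply: sol_sub sf => z /WUV[].
have sgW : sol W g by apply: sol_sub sg => z /WUV[].
have fx : u x = f (s x) by exact: (nbhs_singleton nf).
have gx : v x = g (s x) by exact: (nbhs_singleton ng).
near=> y => Ky.
have -> : u y = f (s y) by move: Ky; near: y.
have -> : v y = g (s y) by move: Ky; near: y.
have Wy : W (s y) by move: Ky; near: y; exact: within_near.
by rewrite fx gx; split; exact: uW.
Unshelve. all: by end_near. Qed.

(** Connectedness of the overlap spreads the agreement at [r] to all of it. A point outside one
    closed piece has a neighbourhood that sees only the other piece; at a common point the two local
    solutions coincide on a trivializing set. *)
Lemma continuation_glue (T : topologicalType) (A B : set T) (s : T -> M) u v r :
  closed A -> closed B -> {within A `|` B, continuous s} ->
  connected (A `&` B) -> (A `&` B) r -> u r = v r ->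
  continuation A s u -> continuation B s v ->
  exists w, [/\ continuation (A `|` B) s w, forall x, A x -> w x = u x &
    forall x, B x -> w x = v x].
Proof.
move=> cA cB cs cAB ABr uvr lu lv.
have uv x : A x -> B x -> u x = v x.
  move=> Ax Bx.
  apply: (@continuation_unique _ (A `&` B) s u v r x) => //.
  - by apply: continuous_subspaceW cs => z [? _]; left.
  - by apply: continuation_subset lu => z [].
  - by apply: continuation_subset lv => z [].
pose w x := if `[< A x >] then u x else v x.
have wA x : A x -> w x = u x by move=> Ax; rewrite /w asboolT.
have wB x : B x -> w x = v x.
  by move=> Bx; rewrite /w; case: asboolP => // Ax; exact: uv.
exists w; split => //.
have notin (C : set T) x : closed C -> ~ C x -> \forall y \near x, ~ C y.
  by move=> cC nC; apply: open_nbhs_nbhs; split; [exact: closed_openC|].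
move=> x; have [Ax|nAx] := pselect (A x); have [Bx|nBx] := pselect (B x); last 2 first.
- move=> _; have [V [g [oV Vx sg ng]]] := lv x Bx.
  exists V, g; split => //.
  have := notin _ _ cA nAx; apply: filterS2 ng => y ng nAy [//|By].
  by rewrite wB//; exact: ng.
- by case.
- move=> _; have [U [f [oU Ux sf nf]]] := lu x Ax.
  have [V [g [oV Vx sg ng]]] := lv x Bx.
  have [W [[oW _ _ uW] Wx WUV]] := basis (openI oU oV) (conj Ux Vx).
  have sfW : sol W f by apply: sol_sub sf => z /WUV[].
  have sgW : sol W g by apply: sol_sub sg => z /WUV[].
  exists W, f; split => //; near=> y => ABy.
  have Wy : W (s y) by move: ABy; near: y; apply: within_near => //; left.
  have nfy : A y -> u y = f (s y) by near: y.
  have ngy : B y -> v y = g (s y) by near: y.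
  case: ABy => [Ay|By]; first by rewrite wA ?nfy.
  rewrite wB// ngy//; apply: (uW _ _ (s x)) => //.
  by rewrite -(nbhs_singleton nf)// -(nbhs_singleton ng)// uv.
- move=> _; have [U [f [oU Ux sf nf]]] := lu x Ax.
  exists U, f; split => //.
  have := notin _ _ cB nBx; apply: filterS2 nf => y nf nBy [Ay|//].
  by rewrite wA//; exact: nf.
Unshelve. all: by end_near. Qed.

(** Base point and initial value are both arbitrary, so that a continuation on one piece can be
    restarted from the value it reached on the edge of the next. *)
Definition continuable (T : topologicalType) (K : set T) (s : T -> M) : Prop :=
  forall q a, K q -> exists2 u, continuation K s u & u q = a.

Lemma continuable_glue (T : topologicalType) (A B : set T) (s : T -> M) :
  closed A -> closed B -> {within A `|` B, continuous s} ->
  connected (A `&` B) -> A `&` B !=set0 ->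
  continuable A s -> continuable B s -> continuable (A `|` B) s.
Proof.
move=> cA cB cs cAB [r [Ar Br]] lA lB q a [Aq|Bq].
- have [u lu uq] := lA q a Aq; have [v lv vr] := lB r (u r) Br.
  have [] := @continuation_glue _ A B s u v r => // w [lw wA _].
  by exists w; rewrite ?wA.
- have [v lv vq] := lB q a Bq; have [u lu ur] := lA r (v r) Ar.
  have [] := @continuation_glue _ A B s u v r => // w [lw _ wB].
  by exists w; rewrite ?wB.
Qed.

End local_system.

(** * Connected sets and rectangles in the plane *)

Section convexity.
Variable R : realType.
Local Notation I := (@unit_interval R).

Lemma connected_unit_interval : connected I.
Proof.
apply/connected_intervalP => x y /andP[x0 x1] /andP[y0 y1] z /andP[xz zy].
by apply/andP; split; lra.
Qed.

(** A relatively clopen subset of [A] pulls back along a path to a locally constant condition on the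
    connected unit interval. *)
Lemma path_connected_connected (T : topologicalType) (A : set T) :
  path_connected R A -> connected A.
Proof.
move=> pA B [x Bx] [C oC BC] [D cD BD].
apply/seteqP; split => [z|y Ay]; first by rewrite BC => -[].
have [|c [cc c0 c1 cA]] := pA x y _ Ay; first by move: Bx; rewrite BC => -[].
have I0 : I 0 by apply/andP; rewrite lexx ler01.
have I1 : I 1 by apply/andP; rewrite lexx ler01.
rewrite -c1; move: Bx; rewrite -c0.
apply: (connected_locally_constant (P := B \o c) connected_unit_interval) => //.
move=> t It /=; have [Bt|nBt] := pselect (B (c t)).
  have Ct : C (c t) by move: Bt; rewrite BC => -[].
  apply: filterS (within_near cc It oC Ct) => r CI Ir; split => // _.
  by rewrite BC; split; [exact: cA|exact: CI].
have nDt : (~` D) (c t).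
  by move=> Dt; apply: nBt; rewrite BD; split => //; exact: cA.
apply: filterS (within_near cc It (closed_openC cD) nDt) => r DI Ir; split => //.
by rewrite BD => -[_ Dr]; have := DI Ir.
Qed.

(** Degenerate boxes are included on purpose: two adjacent boxes meet in an edge such as
    [box b b c d], whose connectedness is then an instance of [connected_box]. *)
Definition box (a b c d : R) : set (R * R) :=
  [set x | a <= x.1 <= b] `&` [set x | c <= x.2 <= d].

Lemma closed_box a b c d : closed (box a b c d).
Proof.
have cl (h : R * R -> R) e f : continuous h -> closed [set x | e <= h x <= f].
  move=> ch; have -> : [set x | e <= h x <= f] =
      h @^-1` [set x | e <= x] `&` h @^-1` [set x | x <= f].
    by apply/seteqP; split => x /= => [/andP[]|[-> ->]].
  by apply: closedI; apply: preimage_closed => [x _|]; do ?[exact: ch];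
    [exact: closed_ge|exact: closed_le].
by apply: closedI; apply: cl => x; [exact: cvg_fst|exact: cvg_snd].
Qed.

Lemma connected_box a b c d : connected (box a b c d).
Proof.
apply: path_connected_connected => x y [/= /andP[? ?] /andP[? ?]] [/= /andP[? ?] /andP[? ?]].
exists (fun t => ((1 - t) * x.1 + t * y.1, (1 - t) * x.2 + t * y.2)); split.
- apply: continuous_subspaceT; apply: pair_continuous => t; apply: cvgD;
    apply: cvgM; do ?[exact: cvg_cst|exact: cvg_id];
    by apply: cvgB; [exact: cvg_cst|exact: cvg_id].
- by rewrite subr0 !mul1r !mul0r !addr0 -surjective_pairing.
- by rewrite subrr !mul1r !mul0r !add0r -surjective_pairing.
- by move=> t /andP[? ?]; split => /=; apply/andP; split; nra.
Qed.

Lemma boxU_l a b e c d : a <= b <= e -> box a b c d `|` box b e c d = box a e c d.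
Proof.
move=> /andP[ab be]; apply/seteqP; split => [x [] []|x []] /= /andP[? ?] ?.
- by split => //=; apply/andP; split; lra.
- by split => //=; apply/andP; split; lra.
- by have [?|/ltW ?] := leP x.1 b; [left|right]; split => //=; apply/andP.
Qed.

Lemma boxU_r a b c d e : c <= d <= e -> box a b c d `|` box a b d e = box a b c e.
Proof.
move=> /andP[cd de]; apply/seteqP; split => [x [] []|x []] /= ? /andP[? ?].
- by split => //=; apply/andP; split; lra.
- by split => //=; apply/andP; split; lra.
- by have [?|/ltW ?] := leP x.2 d; [left|right]; split => //=; apply/andP.
Qed.

Lemma boxI_l a b e c d : a <= b <= e -> box a b c d `&` box b e c d = box b b c d.
Proof.
move=> /andP[ab be]; apply/seteqP; split => [x [[]]|x []] /= /andP[? ?] ?.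
  by case=> /= /andP[? ?] _; split => //=; apply/andP; split; lra.
by split; split => //=; apply/andP; split; lra.
Qed.

Lemma boxI_r a b c d e : c <= d <= e -> box a b c d `&` box a b d e = box a b d d.
Proof.
move=> /andP[cd de]; apply/seteqP; split => [x [[]]|x []] /= ? /andP[? ?].
  by case=> /= _ /andP[? ?]; split => //=; apply/andP; split; lra.
by split; split => //=; apply/andP; split; lra.
Qed.

End convexity.

(** * Existence of continuations over the unit square *)

Section square_continuation.
Variables (R : realType) (M : topologicalType).
Variable sol : set M -> (M -> R) -> Prop.
Hypothesis Hsol : local_system sol.
Local Notation I := (@unit_interval R).

Lemma continuable_box_l a b e c d (s : R * R -> M) :
  {within box a e c d, continuous s} -> a <= b <= e -> c <= d ->
  continuable sol (box a b c d) s -> continuable sol (box b e c d) s ->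
  continuable sol (box a e c d) s.
Proof.
move=> cs abe cd; rewrite -(boxU_l _ _ abe) in cs *.
apply: continuable_glue => //; do ?exact: closed_box.
  by rewrite boxI_l//; exact: connected_box.
by exists (b, c); rewrite boxI_l//; split => //=; rewrite !lexx.
Qed.

Lemma continuable_box_r a b c d e (s : R * R -> M) :
  {within box a b c e, continuous s} -> c <= d <= e -> a <= b ->
  continuable sol (box a b c d) s -> continuable sol (box a b d e) s ->
  continuable sol (box a b c e) s.
Proof.
move=> cs cde ab; rewrite -(boxU_r _ _ cde) in cs *.
apply: continuable_glue => //; do ?exact: closed_box.
  by rewrite boxI_r//; exact: connected_box.
by exists (a, d); rewrite boxI_r//; split => //=; rewrite !lexx.
Qed.

Lemma lebesgue_number (s : R * R -> M) : {within I `*` I, continuous s} ->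
  exists2 d : R, 0 < d & forall x, (I `*` I) x -> exists U,
    trivializing sol U /\ forall y, (I `*` I) y -> ball x d y -> U (s y).
Proof.
move=> cs; pose P (d : R) (x : R * R) := exists U,
  trivializing sol U /\ forall y, (I `*` I) y -> ball x d y -> U (s y).
have cI : compact I.
  have -> : I = `[0, 1]%classic by apply/seteqP; split => t; rewrite /= in_itv.
  exact: segment_compact.
have : \forall d \near (0:R)^'+, I `*` I `<=` P d.
  have /near_covering_withinP : near_covering (I `*` I).
    by apply/compact_near_coveringP; exact: compact_setX.
  (* Compactness in its near-covering form: it is enough to find, for each [x], a neighbourhood and
     a bound on [d] that work together. Halving the radius [e] does it, by the triangle
     inequality. *)
  apply => x Ix; have [U [tU Ux _]] := Hsol.2 (s x) setT openT Logic.I.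
  have /nbhs_ballP[e /= e0 eU] : \forall y \near x, (I `*` I) y -> U (s y).
    by apply: within_near => //; case: tU.
  have e20 : 0 < e / 2 by rewrite divr_gt0.
  exists (ball x (e / 2), [set d | d < e / 2]) => /=.
    by split; [exact: nbhsx_ballx|exact: nbhs_right_lt].
  move=> [y d] [/= xy de] Iy; exists U; split => // z Iz yz; apply: eU => //.
  by apply: (ball_split xy); apply: le_ball yz; exact: ltW.
move=> H; near (0:R)^'+ => d; exists d => //.
by near: d.
Unshelve. all: by end_near. Qed.

(** The square is cut into cells smaller than a Lebesgue number. On a cell the continuation is a
    single solution composed with [s]; cells are glued along edges into rows, and rows into the
    square. *)
Lemma continuable_square (s : R * R -> M) :
  {within I `*` I, continuous s} -> continuable sol (I `*` I) s.
Proof.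
move=> cs; have [d d0 dU] := lebesgue_number cs.
have [m md] : exists m : nat, m.+1%:R^-1 < d.
  by exists (Num.truncn d^-1); rewrite invf_plt ?posrE// truncnS_gt.
set N := m.+1 in md.
pose t (j : nat) : R := j%:R / N%:R.
have N0' : 0 < N%:R :> R by rewrite ltr0n.
have tS j : t j.+1 = t j + N%:R^-1 by rewrite /t -natr1 mulrDl mul1r.
have t0 j : 0 <= t j by rewrite divr_ge0.
have t1 j : (j <= N)%N -> t j <= 1.
  by move=> jN; rewrite ler_pdivrMr// mul1r ler_nat.
have Ni0 : 0 < N%:R^-1 :> R by rewrite invr_gt0.
have tle j : t j <= t j.+1 by rewrite tS lerDl ltW.
have sub j j' k k' : (j' <= N)%N -> (k' <= N)%N ->
    box (t j) (t j') (t k) (t k') `<=` I `*` I.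
  move=> jN kN x [/= /andP[? ?] /andP[? ?]].
  have := t1 _ jN; have := t1 _ kN; have := t0 j; have := t0 k.
  by split => /=; apply/andP; split; lra.
have csub j j' k k' : (j' <= N)%N -> (k' <= N)%N ->
    {within box (t j) (t j') (t k) (t k'), continuous s}.
  by move=> jN kN; apply: continuous_subspaceW cs; exact: sub.
have cell j k : (j < N)%N -> (k < N)%N ->
    continuable sol (box (t j) (t j.+1) (t k) (t k.+1)) s.
  move=> jN kN.
  (* The trivializing set is the one attached to the lower left corner. Balls of the plane are
     squares and the side of a cell is less than [d], so the whole cell lies in the ball about that
     corner. *)
  have Ijk : (I `*` I) (t j, t k).
    by apply: (sub j j.+1 k k.+1) => //; split => /=; rewrite lexx tle.
  have [U [[oU _ exU _] sU]] := dU _ Ijk.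
  have bU y : box (t j) (t j.+1) (t k) (t k.+1) y -> U (s y).
    move=> By; apply: sU; first exact: sub By.
    case: By => /= /andP[? ?] /andP[? ?].
    have := tS j; have := tS k => ? ?.
    by split => /=; rewrite /ball /= ltr_distl; apply/andP; split; lra.
  move=> q a Bq; have [f sf fq] := exU (s q) a (bU _ Bq).
  by exists (f \o s) => //; exact: continuation_sol sf bU.
have row n k : (n < N)%N -> (k < N)%N -> continuable sol (box (t 0%N) (t n.+1) (t k) (t k.+1)) s.
  move=> + kN; elim: n => [|n IH] nN; first exact: cell.
  apply: (@continuable_box_l _ (t n.+1)) => //.
  - exact: csub.
  - rewrite tle andbT /t ler_pM2r// ler_nat//.
  - exact/IH/ltnW.
  - exact: cell.
have t00 : t 0%N = 0 by rewrite /t mul0r.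
have tN1 : t N = 1 by rewrite /t mulfV// gt_eqF.
have rows n : (n < N)%N -> continuable sol (box (t 0%N) (t N) (t 0%N) (t n.+1)) s.
  elim: n => [|n IH] nN; first exact: row.
  apply: (@continuable_box_r _ _ _ (t n.+1)) => //.
  - exact: csub.
  - by rewrite tle andbT /t ler_pM2r// ler_nat.
  - by rewrite t00 tN1.
  - exact/IH/ltnW.
  - exact: row.
by have := rows m (ltnSn m); rewrite t00 tN1.
Qed.

End square_continuation.

(** * Monodromy *)

(** Morphisms between local systems act on continuations. This is what later relates the monodromies
    of three different equations. *)
Lemma continuation_map2 (R : realType) (M T : topologicalType)
    (sol1 sol2 sol3 : set M -> (M -> R) -> Prop) (op : R -> R -> R)
    (K : set T) (s : T -> M) u v :
  local_system sol1 -> local_system sol2 ->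
  (forall U f g, open U -> sol1 U f -> sol2 U g ->
    sol3 U (fun x => op (f x) (g x))) ->
  continuation sol1 K s u -> continuation sol2 K s v -> continuation sol3 K s (fun x => op (u x) (v x)).
Proof.
move=> [sub1 _] [sub2 _] opP lu lv x Kx.
have [U [f [oU Ux sf nf]]] := lu x Kx; have [V [g [oV Vx sg ng]]] := lv x Kx.
exists (U `&` V), (fun x => op (f x) (g x)); split => //; first exact: openI.
- apply: opP; first exact: openI.
  + by apply: sub1 sf => z [].
  + by apply: sub2 sg => z [].
- by apply: filterS2 nf ng => y fy gy Ky; rewrite fy// gy.
Qed.

(** The version of [concat_continuous] for paths with arbitrary matching ends, as needed to reach
    points other than the base point. *)
Lemma path_concat (R : realType) (M : topologicalType) (c d : R -> M) :
  {within @unit_interval R, continuous c} ->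
  {within @unit_interval R, continuous d} -> c 1 = d 0 ->
  {within @unit_interval R, continuous (concat_fun c d)}.
Proof.
move=> cc cd cd01; rewrite /concat_fun.
apply: (@Defs.within_continuous_glue _ _ _ _ id (fun t => c (2 * t))
    (fun t => d (2 * t - 1))).
- exact: closed_unit_interval.
- by move=> x; exact: cvg_id.
- refine (Defs.within_continuous_comp (f := fun t : R => 2 * t) cc _ _).
    by move=> t [/andP[? ?] /= ?]; apply/andP; split; lra.
  apply: continuous_subspaceT => x.
  by apply: cvgM; [exact: cvg_cst|exact: cvg_id].
- refine (Defs.within_continuous_comp (f := fun t : R => 2 * t - 1) cd _ _).
    by move=> t [/andP[? ?] /= ?]; apply/andP; split; lra.
  apply: continuous_subspaceT => x.
  apply: cvgB; last exact: cvg_cst.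
  by apply: cvgM; [exact: cvg_cst|exact: cvg_id].
- by move=> x _ ->; rewrite mulfV// subrr.
Qed.

Section transport.
Variables (R : realType) (M : topologicalType).
Variable sol : set M -> (M -> R) -> Prop.
Hypothesis Hsol : local_system sol.
Local Notation I := (@unit_interval R).
Implicit Types (c d : R -> M) (a b : R).

Let I0 : I 0. Proof. by apply/andP; rewrite lexx ler01. Qed.
Let I1 : I 1. Proof. by apply/andP; rewrite lexx ler01. Qed.

(** A solution near [x] with value [u y] there, composed with the constant map, is a constant
    continuation that agrees with [u] at [y]; uniqueness concludes. It serves for the two sides on
    which a homotopy of loops is fixed. *)
Lemma continuation_const (T : topologicalType) (K : set T) (x : M) u y z :
  connected K -> continuation sol K (fun=> x) u -> K y -> K z -> u y = u z.
Proof.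
move=> cK lu Ky Kz; have [U [[oU _ exU _] Ux _]] := Hsol.2 x setT openT Logic.I.
have [f sf fx] := exU x (u y) Ux.
rewrite -{1}fx; apply: (continuation_unique Hsol (s := fun=> x) (K := K) (u := f \o fun=> x)
  (x := y)) => //.
  by apply: continuous_subspaceT => w; exact: cvg_cst.
exact: continuation_sol sf _.
Qed.

(** A path is a map of the square that ignores one coordinate, so no separate subdivision of the
    interval is made. *)
Lemma path_continuation c a : {within I, continuous c} ->
  exists2 u, continuation sol I c u & u 0 = a.
Proof.
move=> cc; have cs : {within I `*` I, continuous (c \o snd)}.
  refine (Defs.within_continuous_comp (f := snd) cc _ _); first by move=> x [].
  by apply: continuous_subspaceT => x; exact: cvg_snd.
have [u lu u0] := continuable_square Hsol cs a (conj I0 I0 : (I `*` I) (0, 0)).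
exists (u \o (fun t => (0, t))) => //.
apply: (continuation_comp (s := c \o snd) (h := fun t : R => (0 : R, t))) lu.
  by move=> t It; split.
by apply: pair_continuous => t; [exact: cvg_cst|exact: cvg_id].
Qed.

Definition transport c a b : Prop :=
  exists u, [/\ continuation sol I c u, u 0 = a & u 1 = b].

Lemma transport_exists c a : {within I, continuous c} -> exists b, transport c a b.
Proof. by move=> cc; have [u lu u0] := path_continuation a cc; exists (u 1), u. Qed.

Lemma transport_unique c a b b' : {within I, continuous c} ->
  transport c a b -> transport c a b' -> b = b'.
Proof.
move=> cc [u [lu u0 <-]] [v [lv v0 <-]].
have h := continuation_unique Hsol (@connected_unit_interval R) cc lu lv I0 I1.
by apply: h; rewrite u0 v0.
Qed.

Lemma transport_eq c d a b : (forall t, I t -> c t = d t) ->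
  transport c a b -> transport d a b.
Proof. by move=> cd [u [lu u0 u1]]; exists u; split => //; exact: continuation_eq lu. Qed.

Lemma transport_reverse c a b : transport c a b -> transport (fun t => c (1 - t)) b a.
Proof.
move=> [u [lu u0 u1]]; exists (fun t => u (1 - t)).
rewrite subr0 subrr; split => //.
apply: (continuation_comp (h := fun t : R => 1 - t)) lu.
  by move=> t /andP[? ?]; apply/andP; split; lra.
by move=> t; apply: cvgB; [exact: cvg_cst|exact: cvg_id].
Qed.

(** Splitting a continuation into halves is only a reparametrization. The converse direction, which
    would need gluing, is recovered where required from existence and uniqueness of transport. *)
Lemma transport_concat c d a b : c 1 = d 0 -> transport (concat_fun c d) a b ->
  exists2 e, transport c a e & transport d e b.
Proof.
move=> cd [u [lu u0 u1]]; exists (u 2^-1).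
- exists (fun t => u (2^-1 * t + 0)); rewrite mulr0 addr0 mulr1 addr0; split => //.
  apply: (@continuation_eq _ _ _ _ _ (concat_fun c d \o (fun t => 2^-1 * t + 0)) _ _ _ _ _
    (continuation_comp (h := fun t : R => 2^-1 * t + 0) _ _ lu)) => //.
  + move=> t /andP[? ?] /=; rewrite /concat_fun ifT; last by lra.
    by congr c; lra.
  + by move=> t /andP[? ?]; apply/andP; split; lra.
  + exact: affine_continuous.
- exists (fun t => u (2^-1 * t + 2^-1)); rewrite mulr0 add0r.
  have h1 : 2^-1 * 1 + 2^-1 = 1 :> R by lra.
  rewrite h1; split => //.
  apply: (@continuation_eq _ _ _ _ _ (concat_fun c d \o (fun t => 2^-1 * t + 2^-1)) _ _ _ _ _
    (continuation_comp (h := fun t : R => 2^-1 * t + 2^-1) _ _ lu)) => //.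
  + move=> t /andP[? ?] /=; rewrite /concat_fun; case: ifPn => h.
      (* At the junction [concat_fun] takes its first branch, so the value is [c 1], to be replaced
         by [d 0]. *)
      have -> : t = 0 by lra.
      by rewrite mulr0 add0r mulfV.
    by congr d; lra.
  + by move=> t /andP[? ?]; apply/andP; split; lra.
  + exact: affine_continuous.
Qed.

Lemma transport_in U f c : open U -> sol U f -> (forall t, I t -> U (c t)) ->
  transport c (f (c 0)) (f (c 1)).
Proof. by move=> oU sf cU; exists (f \o c); split => //; exact: continuation_sol sf cU. Qed.

Section monodromy.
Variable p : M.

(** A continuation over the whole square of the homotopy is constant along the two sides mapped to
    [p]. Its two other sides are therefore continuations along [f] and [g] with the same initial and
    final values. *)
Lemma transport_homotopic (f g : loop R p) a b :
  homotopic f g -> transport f a b -> transport g a b.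
Proof.
move=> [H [cH H0 H1 HI]] fab.
have [u lu u0] := continuable_square Hsol cH a (conj I0 I0 : (I `*` I) (0, 0)).
have vert s : I s -> continuation sol I (fun t => H (s, t)) (fun t => u (s, t)).
  move=> Is; apply: (continuation_comp (h := fun t : R => (s, t))) lu.
    by move=> t It; split.
  by apply: pair_continuous => t; [exact: cvg_cst|exact: cvg_id].
have horiz t : I t -> (forall s, I s -> H (s, t) = p) -> u (0, t) = u (1, t).
  move=> It Hp; apply: (@continuation_const _ I p (fun s => u (s, t)) 0 1) => //.
    exact: connected_unit_interval.
  apply: (continuation_eq (s := fun s => H (s, t)) (u := fun s => u (s, t))) => //.
  apply: (continuation_comp (h := fun s : R => (s, t))) lu.
    by move=> s Is; split.
  by apply: pair_continuous => s; [exact: cvg_id|exact: cvg_cst].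
exists (fun t => u (1, t)); split.
- exact: continuation_eq (vert 1 I1).
- by rewrite -horiz// => s /HI[].
- rewrite -horiz//; last by move=> s /HI[].
  apply: (@transport_unique f a) fab; first exact: loop_continuous.
  by exists (fun t => u (0, t)); split => //; exact: continuation_eq (vert 0 I0).
Qed.

(** The default 0 is never taken, since transport along a loop exists; [monodromyP] shows that any
    representative gives the same value. *)
Definition monodromy (x : pi1 R p) a : R := xget 0 [set b | transport (repr x) a b].

Lemma monodromyP (f : loop R p) a b :
  transport f a b <-> b = monodromy (pi1_class f) a.
Proof.
have mf : transport f a (monodromy (pi1_class f) a).
  have [b' rb'] := transport_exists a (loop_continuous (l := repr (pi1_class f))).
  apply: (transport_homotopic (repr_pi1_class f)).
  exact: (@xgetI _ 0 _ b').
split => [fab|-> //].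
exact: (transport_unique (loop_continuous (l := f)) fab mf).
Qed.

(** A product of classes runs its left factor first, so the action is on the right;
    [nilpotent_affine_fixpoint] is stated with this order. *)
Lemma monodromyM x y a : monodromy (x * y)%g a = monodromy y (monodromy x a).
Proof.
elim/pi1_classW: x => f; elim/pi1_classW: y => g.
have -> : (pi1_class f * pi1_class g)%g = pi1_class (concat f g) by exact: pi1_classM.
have fg : transport (concat f g) a (monodromy (pi1_class (concat f g)) a).
  exact: (proj2 (monodromyP _ _ _)).
have [|e fe ge] := transport_concat _ fg; first by rewrite loop1 loop0.
by move/monodromyP: fe ge => -> /monodromyP.
Qed.

Lemma monodromy1 a : monodromy 1%g a = a.
Proof.
suff /monodromyP h : transport (@const_loop R M p) a a by exact/esym/h.
have [U [[oU _ exU _] Up _]] := Hsol.2 p setT openT Logic.I.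
have [f sf <-] := exU p a Up.
exact: (@transport_in U f (fun=> p) oU sf (fun _ _ => Up)).
Qed.

(** The value of [F] at [x] is [a] transported along any path from [p] to [x]. Invariance of [a]
    makes it independent of the path, and prolonging paths inside a trivializing set shows that [F]
    is a solution there. *)
Lemma global_section a : connected [set: M] ->
  (forall x : pi1 R p, monodromy x a = a) -> exists F : M -> R,
  forall x, exists U f, [/\ open U, U x, sol U f & forall y, U y -> F y = f y].
Proof.
move=> cM fixa.
pose reach x b := exists c, [/\ {within I, continuous c}, c 0 = p, c 1 = x &
  transport c a b].
have reach_unique x b b' : reach x b -> reach x b' -> b = b'.
  move=> [c [cc c0 c1 cb]] [d [cd d0 d1 db]].
  have crd : {within I, continuous (fun t => d (1 - t))}.
    refine (Defs.within_continuous_comp (f := fun t : R => 1 - t) cd _ _).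
      by move=> t /andP[? ?]; apply/andP; split; lra.
    by apply: continuous_subspaceT => t; apply: cvgB; [exact: cvg_cst|exact: cvg_id].
  have cd01 : c 1 = d (1 - 0) by rewrite subr0 c1 d1.
  (* Going out along [c] and back along [d] is a loop, which fixes [a]. Reversing the second half
     shows that [d] carries [a] to the value reached by [c]. *)
  pose l := concat_fun c (fun t => d (1 - t)).
  have l0 : l 0 = p by rewrite /l /concat_fun invr_ge0 ler0n mulr0.
  have l1 : l 1 = p.
    rewrite /l /concat_fun ifF; last by apply/negbTE; rewrite -ltNge; lra.
    have -> : 1 - (2 * 1 - 1) = 0 :> R by lra.
    by [].
  pose L := Loop (path_concat cc crd cd01) l0 l1.
  have : transport L a a by apply/monodromyP; rewrite fixa.
  move=> /(transport_concat cd01)[e ce de].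
  rewrite (transport_unique cc cb ce).
  apply: (transport_unique cd _ db).
  apply: transport_eq (transport_reverse de) => t It.
  by congr d; lra.
have reach_ext U f x y : trivializing sol U -> sol U f -> U x -> U y ->
    reach x (f x) -> reach y (f y).
  move=> [oU pU _ _] sf Ux Uy [c [cc c0 c1 cb]].
  have [d [cd d0 d1 dU]] := pU x y Ux Uy.
  have cd01 : c 1 = d 0 by rewrite c1 d0.
  have ccd := path_concat cc cd cd01.
  exists (concat_fun c d); split => //.
  - by rewrite /concat_fun invr_ge0 ler0n mulr0.
  - rewrite /concat_fun ifF; last by apply/negbTE; rewrite -ltNge; lra.
    have -> : 2 * 1 - 1 = 1 :> R by lra.
    by [].
  - have [b lb] := transport_exists a ccd.
    have [e ce de] := transport_concat cd01 lb.
    have ex : e = f x by exact: (transport_unique cc ce cb).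
    have := transport_in oU sf dU; rewrite d0 d1 -ex => de'.
    by rewrite -(transport_unique cd de de').
(* Being reachable from [p] is locally constant because trivializing sets are path connected, so
   connectedness of [M] is enough. *)
have reach_total x : exists b, reach x b.
  apply: (@connected_locally_constant _ setT (fun x => exists b, reach x b) cM _
    p x) => //.
  - move=> y _; have [U [tU Uy _]] := Hsol.2 y setT openT Logic.I.
    have [oU _ exU _] := tU.
    apply: filterS (open_nbhs_nbhs (conj oU Uy)) => z Uz _.
    split => -[b rb].
      have [f sf fz] := exU z b Uz.
      by exists (f y); apply: (reach_ext U f z y) => //; rewrite fz.
    have [f sf fy] := exU y b Uy.
    by exists (f z); apply: (reach_ext U f y z) => //; rewrite fy.
  - exists a, (fun=> p); split => //.
      by apply: continuous_subspaceT => t; exact: cvg_cst.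
    by have /monodromyP : a = monodromy (pi1_class (@const_loop R M p)) a
      by rewrite fixa.
have [F FP] := choice reach_total.
exists F => x; have [U [tU Ux _]] := Hsol.2 x setT openT Logic.I.
have [oU _ exU _] := tU; have [f sf fx] := exU x (F x) Ux.
exists U, f; split => // y Uy; apply: (reach_unique y) => //.
by apply: (reach_ext U f x y) => //; rewrite fx.
Qed.

End monodromy.
End transport.

(** * The twisted equation on a ball *)

Section directional_derivatives.
Variables (R : realType) (n : nat).
Local Notation V := 'rV[R]_n.

Lemma ball_segment (x0 x y : V) (r t : R) : ball x0 r x -> ball x0 r y ->
  0 <= t <= 1 -> ball x0 r (x + t *: (y - x)).
Proof.
rewrite -ball_normE /= => bx bY /andP[t0 t1].
have -> : x0 - (x + t *: (y - x)) = (1 - t) *: (x0 - x) + t *: (x0 - y).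
  by rewrite !scalerBr !scalerBl !scale1r; apply/rowP => i; rewrite !mxE; ring.
apply: (le_lt_trans (ler_normD _ _)); rewrite !normrZ.
rewrite (ger0_norm t0) ger0_norm ?subr_ge0//.
have [->|tn0] := eqVneq t 0; first by rewrite subr0 mul1r mul0r addr0.
have tp : 0 < t by rewrite lt_neqAle eq_sym tn0.
have h1 : (1 - t) * `|x0 - x| <= (1 - t) * r.
  by rewrite ler_wpM2l ?subr_ge0// ltW.
have h2 : t * `|x0 - y| < t * r by rewrite ltr_pM2l.
by rewrite [ltRHS](_ : r = (1 - t) * r + t * r); [exact: ler_ltD|ring].
Qed.

Lemma is_derive_line (W : normedModType R) (f : V -> W) (x v : V) (t : R) d :
  is_derive (x + t *: v) v f d ->
  is_derive t (1 : R) (fun s : R => f (x + s *: v)) d.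
Proof.
have E : (fun h : R => h^-1 *: (((fun s : R => f (x + s *: v)) \o shift t) (h *: (1 : R))
      - f (x + t *: v))) =
    (fun h : R => h^-1 *: ((f \o shift (x + t *: v)) (h *: v) - f (x + t *: v))).
  apply/funext => h /=; congr (_ *: (f _ - _)).
  by rewrite [_%:A]mulr1 scalerDl addrCA.
by move=> [dv df]; split; [rewrite /derivable E|rewrite -df /derive E].
Qed.

(** Joint continuity from continuity in the point alone: in finite dimension linearity writes
    [L y q] as the sum of the [q_k L y e_k], where each factor converges separately. *)
Lemma cvg_linear_form (L : V -> V -> R) (x u : V) :
  (\forall y \near x, scalar (L y)) ->
  (forall v, {for x, continuous (L ^~ v)}) ->
  L z.1 z.2 @[z --> (x, u)] --> L x u.
Proof.
move=> linL contL.
have LE y : scalar (L y) -> forall q, L y q =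
    \sum_(k < n) q ord0 k * L y (delta_mx ord0 k).
  move=> lL q; pose l := GRing.isLinear.Build R V R _ (L y) lL.
  pose Ly : {linear V -> R | *%R} := HB.pack (L y) l.
  rewrite {1}[q]row_sum_delta -[L y]/(Ly : _ -> _) linear_sum.
  by apply: eq_bigr => k _; rewrite linearZ.
rewrite (LE x (nbhs_singleton linL)).
have near_eq : \forall z \near (x, u),
    \sum_(k < n) (z.2 : V) ord0 k * L z.1 (delta_mx ord0 k) = L z.1 z.2.
  have : \forall z \near (x, u), scalar (L z.1) by exact: cvg_fst linL.
  by apply: filterS => z /LE ->.
apply: cvg_trans (near_eq_cvg near_eq) _.
apply: (cvg_big (Ff := fun k (z : V * V) => z.2 ord0 k * L z.1 (delta_mx ord0 k))
  (Fa := fun k => u ord0 k * L x (delta_mx ord0 k)) (@add_continuous R)).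
move=> k _; apply: cvgM.
  exact: (@cvg_comp _ _ _ snd (fun q : V => q ord0 k) _ _ _ cvg_snd
    (@coord_continuous _ _ _ ord0 k u)).
exact: (@cvg_comp _ _ _ fst (L ^~ (delta_mx ord0 k)) _ _ _ cvg_fst (contL _)).
Qed.

Section continuously_differentiable.
Variables (g : V -> R) (L : V -> V -> R) (x0 : V) (r : R).
Hypothesis dg : forall y v, ball x0 r y -> is_derive y v g (L y v).

Lemma mean_value_segment x y : ball x0 r x -> ball x0 r y ->
  exists2 t, 0 <= t <= 1 & g y - g x = L (x + t *: (y - x)) (y - x).
Proof.
move=> Bx By.
pose f (t : R) := g (x + t *: (y - x)).
have df (t : R) : 0 <= t <= 1 -> is_derive t 1 f (L (x + t *: (y - x)) (y - x)).
  by move=> t01; apply: is_derive_line; apply: dg; exact: ball_segment.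
have [|t||t t01 ft] := @MVT_segment R f (fun t => L (x + t *: (y - x)) (y - x)) 0 1.
- exact: ler01.
- by rewrite in_itv /= => /andP[t0 t1]; apply: df; rewrite !ltW.
- apply: derivable_within_continuous => t; rewrite in_itv /= => t01.
  by have [] := df t t01.
exists t; first by move: t01; rewrite in_itv.
by move: ft; rewrite /f scale1r scale0r addr0 subr0 mulr1 (addrC x (y - x)) subrK.
Qed.

Hypothesis linL : forall y, ball x0 r y -> scalar (L y).
Hypothesis contL : forall y v, ball x0 r y -> {for y, continuous (L ^~ v)}.

Let near_ball x : ball x0 r x -> \forall y \near x, ball x0 r y.
Proof. by move=> Bx; apply: open_nbhs_nbhs; split => //; exact: ball_open. Qed.

Let cvgL x u : ball x0 r x -> L z.1 z.2 @[z --> (x, u)] --> L x u.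
Proof.
move=> Bx; apply: cvg_linear_form => [|v]; last exact: contL.
by apply: filterS (near_ball Bx) => y; exact: linL.
Qed.

(** By the mean value theorem [g y - g x] is [L] at a point of the segment applied to [y - x]. This
    is small by joint continuity of [L] at [(x, 0)], where [L] vanishes. *)
Lemma continuous_of_derive x : ball x0 r x -> {for x, continuous g}.
Proof.
move=> Bx; apply/(@cvgrPdist_lt _ _ _ (nbhs x) (nbhs_filter x)) => e e0.
have Lx0 : L x 0 = 0.
  by have := linL Bx (-1) 0 0; rewrite scaler0 addr0 mulN1r addNr.
have /cvgrPdist_lt /(_ e e0) := cvgL (u := 0) Bx.
rewrite Lx0 => -[[P Q] /= [Px Q0] PQ].
have /nbhs_ballP[s /= s0 sP] : nbhs x (P `&` ball x0 r).
  by apply: filterI => //; exact: near_ball.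
have nQ : \forall y \near x, Q (y - x).
  have : (y - x) @[y --> x] --> x - x by exact: (cvgB cvg_id (cvg_cst x)).
  by rewrite subrr; apply.
near=> y.
have xy : ball x s y by near: y; exact: nbhsx_ballx.
have [||t t01 gxy] := @mean_value_segment x y; do ?by have [] := sP y xy.
rewrite distrC gxy.
have /PQ /= : (P `*` Q) (x + t *: (y - x), y - x).
  split => /=; last by near: y.
  have xx : ball x s x by exact: ballxx.
  by have [] := sP _ (ball_segment xx xy t01).
by rewrite sub0r normrN.
Unshelve. all: by end_near. Qed.

(** Chain rule along a curve. The mean value theorem and linearity turn the difference quotient of
    [g \o c] into [L] at a nearby point applied to the difference quotient of [c]; joint continuity
    of [L] at [(c t, u)] gives the limit. *)
Lemma is_derive_curve (c : R -> V) (u : V) (t : R) : ball x0 r (c t) ->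
  is_derive t 1 c u -> is_derive t 1 (g \o c) (L (c t) u).
Proof.
move=> Bt dc; set x := c t in Bt *.
have cc : {for t, continuous c}.
  by apply: differentiable_continuous; apply/derivable1_diffP.
have cq : (fun h : R => h^-1 *: (c (h + t) - c t)) @ 0^' --> u.
  have [dc1 dc2] := dc; rewrite -[u]dc2 /derive.
  have E : (fun h : R => h^-1 *: (c (h + t) - c t)) =
      (fun h : R => h^-1 *: ((c \o shift t) (h *: (1 : R)) - c t)).
    by apply/funext => h /=; rewrite [_%:A]mulr1.
  by rewrite E; exact: dc1.
suff cg : (fun h : R => h^-1 *: (g (c (h + t)) - g (c t))) @ 0^' --> L x u.
  have E : (fun h : R => h^-1 *: (((g \o c) \o shift t) (h *: (1 : R)) - (g \o c) t)) =
    (fun h : R => h^-1 *: (g (c (h + t)) - g (c t))).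
    by apply/funext => h /=; rewrite [_%:A]mulr1.
  split; first by rewrite /derivable E; apply/cvg_ex; exists (L x u).
  by rewrite /derive E; apply/cvg_lim.
apply/cvgrPdist_lt => e e0.
have /cvgrPdist_lt /(_ e e0) := cvgL (u := u) Bt.
move=> -[[P Q] /= [Px Qu] PQ].
have /nbhs_ballP[s /= s0 sP] : nbhs x (P `&` ball x0 r).
  by apply: filterI => //; exact: near_ball.
have near_c : \forall h \near 0^', ball x s (c (h + t)).
  apply: nbhs_dnbhs; have : c (h + t) @[h --> 0] --> c (0 + t).
    by apply: continuous_comp; [apply: cvgD; [exact: cvg_id|exact: cvg_cst]|rewrite add0r].
  by rewrite add0r; apply; exact: nbhsx_ballx.
near=> h.
have h0 : h != 0 by near: h; exact: nbhs_dnbhs_neq.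
have xy : ball x s (c (h + t)) by near: h.
have [||a a01 gxy] := @mean_value_segment x (c (h + t)); do ?by have [] := sP _ xy.
have Qh : Q (h^-1 *: (c (h + t) - x)) by near: h; exact: (cq Q Qu).
set y := c (h + t) in xy gxy Qh *.
have /PQ /= : (P `*` Q) (x + a *: (y - x), h^-1 *: (y - x)).
  split => //=.
  have xx : ball x s x by exact: ballxx.
  by have [] := sP _ (ball_segment xx xy a01).
rewrite gxy.
have [_ By] := sP _ (ball_segment (ballxx _ s0) xy a01).
have := linL By h^-1 (y - x) 0.
have := linL By (-1) 0 0; rewrite scaler0 addr0 mulN1r addNr => L0.
by have := linL By h^-1 (y - x) 0; rewrite L0 !addr0 => ->.
Unshelve. all: by end_near. Qed.

End continuously_differentiable.
End directional_derivatives.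

Section within_arith.
Variables (R : realType) (T : topologicalType) (A : set T).

Lemma within_continuousD (f g : T -> R) : {within A, continuous f} ->
  {within A, continuous g} -> {within A, continuous (fun x => f x + g x)}.
Proof. by move=> cf cg x; exact: (cvgD (cf x) (cg x)). Qed.

Lemma within_continuousM (f g : T -> R) : {within A, continuous f} ->
  {within A, continuous g} -> {within A, continuous (fun x => f x * g x)}.
Proof. by move=> cf cg x; exact: (cvgM (cf x) (cg x)). Qed.

End within_arith.

(** * The Poincare lemma by integration along radii *)

Section poincare.
Variables (R : realType) (n : nat).
Local Notation V := 'rV[R]_n.
Local Notation mu := (@lebesgue_measure R).
Variables (w : V -> V -> R) (dw : V -> V -> V -> R) (x0 : V) (r : R).
Local Notation B := (ball x0 r).
Hypothesis r0 : 0 < r.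
Hypothesis linw : forall y, B y -> scalar (w y).
Hypothesis contw : forall v, {within B, continuous (w ^~ v)}.
Hypothesis dwP : forall y u v, B y -> is_derive y u (w ^~ v) (dw y u v).
Hypothesis contdw : forall u v, {within B, continuous (fun y => dw y u v)}.
Hypothesis dw_sym : forall y u v, B y -> dw y u v = dw y v u.

Definition cone_integral (x : V) : R :=
  \int[mu]_(t in `[0, 1]) w (x0 + t *: (x - x0)) (x - x0).

Let B_segment x (t : R) : B x -> 0 <= t <= 1 -> B (x0 + t *: (x - x0)).
Proof. by move=> Bx t01; apply: ball_segment => //; exact: ballxx. Qed.

(* By symmetry of [dw] the integrand is the derivative of [t * w (x0 + t *: (x - x0)) v]. *)
Lemma radial_integral x v : B x ->
  \int[mu]_(t in `[0, 1])
    (t * dw (x0 + t *: (x - x0)) v (x - x0) + w (x0 + t *: (x - x0)) v) = w x v.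
Proof.
move=> Bx; set z := x - x0; pose p (t : R) := x0 + t *: z.
have Bp t : `[0, 1]%classic t -> B (p t).
  by rewrite /= in_itv => t01; exact: B_segment.
have cp : {within `[0, 1], continuous p}.
  apply: continuous_subspaceT => t; apply: cvgD; first exact: cvg_cst.
  by apply: cvgZ; [exact: cvg_id|exact: cvg_cst].
pose Phi (t : R) := t * w (p t) v.
pose phi (t : R) := t * dw (p t) v z + w (p t) v.
have dPhi (t : R) : 0 <= t <= 1 -> is_derive t 1 Phi (phi t).
  move=> t01; have dline := is_derive_line (dwP z v (B_segment Bx t01)).
  refine (is_derive_eq (f := Phi) (is_deriveM (is_derive_id t (1 : R)) dline) _).
  rewrite /phi /p dw_sym; last exact: B_segment.
  by rewrite /GRing.scale /= mulr1.
have cPhi (t : R) : 0 <= t <= 1 -> {for t, continuous Phi}.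
  move=> t01; apply: differentiable_continuous; apply/derivable1_diffP.
  by have [] := dPhi t t01.
rewrite /Rintegral (@continuous_FTC2 _ phi Phi 0 1)//.
- by rewrite /= /Phi /p mul0r subr0 mul1r scale1r addrC subrK.
- apply: within_continuousD; last first.
    exact: (Defs.within_continuous_comp (@contw v) Bp cp).
  apply: within_continuousM.
    by apply: continuous_subspaceT => t; exact: cvg_id.
  exact: (Defs.within_continuous_comp (@contdw v z) Bp cp).
- split.
  + move=> t; rewrite in_itv /= => /andP[t0 t1].
    have t01 : 0 <= t <= 1 by rewrite !ltW.
    by have [] := dPhi t t01.
  + by apply: cvg_at_right_filter; apply: cPhi; rewrite lexx ler01.
  + by apply: cvg_at_left_filter; apply: cPhi; rewrite lexx ler01.
- move=> t; rewrite in_itv /= => /andP[t0 t1].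
  have t01 : 0 <= t <= 1 by rewrite !ltW.
  by have [_] := dPhi t t01; rewrite derive1E.
Qed.

(** Differentiation under the integral sign along [x + s *: v]; at [s = 0] the differentiated
    integrand is the one computed in [radial_integral]. *)
Lemma is_derive_cone_integral x v : B x -> is_derive x v cone_integral (w x v).
Proof.
move=> Bx; set z := x - x0.
pose p (s t : R) := x0 + t *: (x + s *: v - x0).
have [e e0 eB] : exists2 e : R, 0 < e & forall s, -e <= s <= e -> B (x + s *: v).
  have : \forall s \near (0 : R), B (x + s *: v).
    have : x + s *: v @[s --> 0] --> x + (0 : R) *: v.
      apply: cvgD; first exact: cvg_cst.
      by apply: cvgZ; [exact: cvg_id|exact: cvg_cst].
    rewrite scale0r addr0; apply; apply: open_nbhs_nbhs; split => //.
    exact: ball_open.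
  (* Halving the radius keeps the closed interval of parameters inside the ball, so that the
     parameter domain [K] is compact. *)
  move=> /nbhs_ballP[e /= e0 eB]; exists (e / 2); first by rewrite divr_gt0.
  move=> s /andP[s1 s2]; apply: eB; rewrite /ball /= ltr_distl.
  by apply/andP; split; lra.
have Bp s t : - e <= s <= e -> 0 <= t <= 1 -> B (p s t).
  by move=> se t01; apply: B_segment => //; exact: eB.
pose K : set (R * R) := `[-e, e]%classic `*` `[0, 1]%classic.
have BpK st : K st -> B (p st.1 st.2).
  by case: st => s t [/=]; rewrite !in_itv; exact: Bp.
have cK : compact K by apply: compact_setX; exact: segment_compact.
have cp : {within K, continuous (fun st : R * R => p st.1 st.2)}.
  apply: continuous_subspaceT => st; apply: cvgD; first exact: cvg_cst.
  apply: cvgZ; first exact: cvg_snd.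
  apply: cvgB; last exact: cvg_cst.
  apply: cvgD; first exact: cvg_cst.
  by apply: cvgZ; [exact: cvg_fst|exact: cvg_cst].
pose phi (s t : R) := w (p s t) (x + s *: v - x0).
(* The derivative of [phi] in [s]. The direction [z + s *: v] also moves with [s]: this produces the
   term [w (p s t) v] and the last term, which vanishes at [s = 0]. *)
pose psi (s t : R) :=
  t * dw (p s t) v z + (w (p s t) v + s * (t * dw (p s t) v v)).
have phiE s t : - e <= s <= e -> 0 <= t <= 1 ->
    phi s t = w (p s t) z + s * w (p s t) v.
  move=> se t01; have lw := linw (Bp _ _ se t01).
  by rewrite /phi addrAC addrC lw addrC.
have dphi s t : - e < s < e -> 0 <= t <= 1 -> is_derive s 1 (phi ^~ t) (psi s t).
  move=> /andP[s1 s2] t01; have se : - e <= s <= e by rewrite !ltW.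
  have dp q : is_derive s 1 (fun s => w (p s t) q) (t * dw (p s t) v q).
    pose f (a : R) := w ((x0 + t *: z) + a *: v) q.
    have pE a : p a t = (x0 + t *: z) + (t * a) *: v.
      by rewrite /p addrAC scalerDr scalerA addrA.
    have df : is_derive (t * s) 1 f (dw (p s t) v q).
      apply: (@is_derive_line R n R (w ^~ q) (x0 + t *: z) v (t * s)).
      by rewrite -pE; apply: dwP; exact: Bp.
    have -> : (fun s => w (p s t) q) = f \o ( *%R t).
      by apply/funext => a; rewrite /= /f pE.
    rewrite mulrC; apply: is_derive1_comp.
    apply: (is_derive_eq (f := *%R t) (is_deriveZ t (is_derive_id s (1 : R)))).
    by rewrite /GRing.scale /= mulr1.
  have := is_deriveD (dp z) (is_deriveM (is_derive_id s (1 : R)) (dp v)).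
  move=> D; apply: (near_eq_is_derive (f := fun s => w (p s t) z + s * w (p s t) v) _
    (is_derive_eq D _)).
    have : \forall a \near s, a \in `]-e, e[.
      have s_in : s \in `]-e, e[ by rewrite in_itv /= s1.
      exact: near_in_itvoo s_in.
    apply: filterS => a; rewrite in_itv /= => /andP[a1 a2].
    by rewrite phiE// !ltW.
  by rewrite /psi /GRing.scale /= mulr1 [s * _ + _]addrC.
have cpsi : {within K, continuous (fun st : R * R => psi st.1 st.2)}.
  have c1 : {within K, continuous (fun st : R * R => st.1)}.
    by apply: continuous_subspaceT => st; exact: cvg_fst.
  have c2 : {within K, continuous (fun st : R * R => st.2)}.
    by apply: continuous_subspaceT => st; exact: cvg_snd.
  have cdwp q : {within K, continuous (fun st : R * R => dw (p st.1 st.2) v q)}.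
    exact: (Defs.within_continuous_comp (@contdw v q) BpK cp).
  apply: within_continuousD; first exact: within_continuousM.
  apply: within_continuousD.
    exact: (Defs.within_continuous_comp (@contw v) BpK cp).
  by apply: within_continuousM => //; exact: within_continuousM.
(* A continuous function on the compact [K] is bounded; the constant [C] is the dominating
   function. *)
have [C C0 psiC] : exists2 C, 0 <= C & forall s t, K (s, t) -> `|psi s t| <= C.
  have [m [_ mP]] := compact_bounded (continuous_compact cpsi cK).
  exists (`|m| + 1) => [|s t Kst]; first by rewrite addr_ge0.
  apply: (mP (`|m| + 1)); last by exists (s, t).
  by rewrite (le_lt_trans (ler_norm m))// ltrDl.
have e_itv s : s \in `]-e, e[ -> - e <= s <= e.
  by rewrite in_itv /= => /andP[s1 s2]; rewrite !ltW.
have I0 : `]-e, e[%classic 0 by rewrite /= in_itv /= oppr_lt0 e0.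
have intphi s : `]-e, e[%classic s -> mu.-integrable `[0, 1] (EFin \o phi s).
  move=> /e_itv se; apply: continuous_compact_integrable; first exact: segment_compact.
  have cps : {within `[0, 1], continuous (p s)}.
    apply: continuous_subspaceT => t; apply: cvgD; first exact: cvg_cst.
    by apply: cvgZ; [exact: cvg_id|exact: cvg_cst].
  have Bps t : `[0, 1]%classic t -> B (p s t).
    by rewrite /= in_itv => t01; exact: Bp.
  exact: (Defs.within_continuous_comp (@contw (x + s *: v - x0)) Bps cps).
have dphi' s t : `]-e, e[%classic s -> `[0, 1]%classic t ->
    is_derive s 1 (phi ^~ t) (psi s t).
  by rewrite /= !in_itv; exact: dphi.
have := @cvg_differentiation_under_integral R _ _ mu phi `[0, 1]
  (measurable_itv _) 0 (- e) e I0 intphi.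
move=> /(_ (fun s t se t01 => (dphi' s t se t01).(ex_derive)) (cst C) (fun=> C0)).
have intC : mu.-integrable `[0, 1] (EFin \o cst C).
  apply: continuous_compact_integrable; first exact: segment_compact.
  by apply: continuous_subspaceT => t; exact: cvg_cst.
have d1 s t : `]-e, e[%classic s -> `[0, 1]%classic t ->
    partial1of2 phi s t = psi s t.
  by move=> se t01; rewrite partial1of2E; exact: (dphi' s t se t01).(derive_val).
have d1C s t : `]-e, e[%classic s -> `[0, 1]%classic t ->
    `|partial1of2 phi s t| <= cst C t.
  move=> se t01; rewrite d1//; apply: psiC; split => //=.
  by rewrite in_itv; exact: e_itv.
move=> /(_ intC d1C).
have -> : \int[mu]_(t in `[0, 1]) partial1of2 phi 0 t = w x v.
  rewrite -(radial_integral v Bx); apply: eq_Rintegral => t; rewrite inE => t01.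
  by rewrite d1// /psi /p scale0r addr0 mul0r addr0.
have E : (fun h : R => h^-1 *: ((cone_integral \o shift x) (h *: v) - cone_integral x)) =
    (fun h : R => h^-1 *: ((fun s => \int[mu]_(t in `[0, 1]) phi s t) (h + 0) -
      (fun s => \int[mu]_(t in `[0, 1]) phi s t) 0)).
  apply/funext => h /=; rewrite /cone_integral /phi /p addr0 scale0r addr0.
  by rewrite [h *: v + x]addrC.
move=> H; split; first by rewrite /derivable E; apply/cvg_ex; exists (w x v).
by rewrite /derive E; apply/cvg_lim.
Qed.

End poincare.

(** * Existence, uniqueness and continuity of twisted solutions *)

Section twisted_equation.
Variables (R : realType) (n : nat).
Local Notation V := 'rV[R]_n.

Lemma is_derive_line0 (W : normedModType R) (f : V -> W) (x v : V) d :
  is_derive (0 : R) (1 : R) (fun s : R => f (x + s *: v)) d -> is_derive x v f d.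
Proof.
have E : (fun h : R => h^-1 *: (((fun s : R => f (x + s *: v)) \o shift 0) (h *: (1 : R))
      - f (x + 0 *: v))) =
    (fun h : R => h^-1 *: ((f \o shift x) (h *: v) - f x)).
  apply/funext => h /=.
  by rewrite [_%:A]mulr1 scale0r !addr0 [_ + x]addrC.
by move=> [dv df]; split;
  [move: dv; rewrite /derivable E|rewrite -df /derive E].
Qed.

Lemma is_derive_post_comp (f : R -> R) (g : V -> R) (x v : V) a b :
  is_derive (g x) 1 f a -> is_derive x v g b -> is_derive x v (f \o g) (a * b).
Proof.
move=> df dg; apply: is_derive_line0.
apply: (@is_derive1_comp R f (fun s => g (x + s *: v))).
  by rewrite scale0r addr0.
by apply: is_derive_line; rewrite scale0r addr0.
Qed.

(* [a y v] is the value at the point [y] of a 1-form on the tangent vector [v] *)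
Definition C1_form (B : set V) (a : V -> V -> R) (da : V -> V -> V -> R) : Prop :=
  [/\ forall y, B y -> scalar (a y),
      forall v, {within B, continuous (a ^~ v)},
      forall y u v, B y -> is_derive y u (a ^~ v) (da y u v) &
      forall u v, {within B, continuous (fun y => da y u v)}].

Variables (x0 : V) (r : R).
Local Notation B := (ball x0 r).

Lemma within_ball_continuous (f : V -> R) :
  {within B, continuous f} <-> forall y, B y -> {for y, continuous f}.
Proof.
have oB : open (B : set V) by exact: ball_open.
rewrite (continuous_open_subspace f oB).
by split => cf y; [move=> By; apply: cf; rewrite inE|rewrite inE; exact: cf].
Qed.

Lemma poincare a da : 0 < r -> C1_form B a da ->
  (forall y u v, B y -> da y u v = da y v u) ->
  exists f, (forall y v, B y -> is_derive y v f (a y v)) /\ {within B, continuous f}.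
Proof.
move=> r0 [lin ca daP cda] sym; exists (cone_integral a x0).
have df y v : B y -> is_derive y v (cone_integral a x0) (a y v).
  exact: (is_derive_cone_integral r0 lin ca daP cda sym).
split => //; apply/within_ball_continuous => y By.
apply: (continuous_of_derive df lin) => // z v Bz.
by move/within_ball_continuous : (ca v); apply.
Qed.

Variables (theta w : V -> V -> R) (dtheta dw : V -> V -> V -> R).
Hypothesis r0 : 0 < r.
Hypothesis theta1 : C1_form B theta dtheta.
Hypothesis w1 : C1_form B w dw.
Hypothesis theta_closed : forall y u v, B y -> dtheta y u v = dtheta y v u.
Hypothesis w_closed : forall y u v, B y ->
  dw y u v - dw y v u = theta y u * w y v - theta y v * w y u.

Definition twisted_solution (g : V -> R) : Prop :=
  forall y v, B y -> is_derive y v g (theta y v * g y + w y v).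

Lemma is_derive_expN (h : V -> R) y v d :
  is_derive y v h d -> is_derive y v (fun z => expR (- h z)) (- (expR (- h y) * d)).
Proof.
move=> dh; have := is_derive_post_comp (is_derive_expR _) (is_deriveN dh).
by rewrite mulrN.
Qed.

(* [d (exp(-h) w) = exp(-h) (dw - theta /\ w) = 0] when [dh = theta], and
   [exp(h) F] then solves the equation for any primitive [F] of [exp(-h) w]. *)
Lemma twisted_solution_exists y c : B y -> exists g,
  [/\ twisted_solution g, {within B, continuous g} & g y = c].
Proof.
move=> By; have [linT cT dT cdT] := theta1; have [linw cw dwP cdw] := w1.
have [h [dh ch]] := poincare r0 theta1 theta_closed.
have ceN : {within B, continuous (fun z => expR (- h z))}.
  apply/within_ball_continuous => z Bz; move/within_ball_continuous : ch => ch.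
  exact: (@continuous_comp _ _ _ (fun z => - h z) expR _ (cvgN (ch z Bz))
    (@continuous_expR R _)).
have ce : {within B, continuous (fun z => expR (h z))}.
  apply/within_ball_continuous => z Bz; move/within_ball_continuous : ch => ch.
  exact: (@continuous_comp _ _ _ h expR _ (ch z Bz) (@continuous_expR R _)).
pose a z v := expR (- h z) * w z v.
pose da z u v := expR (- h z) * (dw z u v - theta z u * w z v).
have a1 : C1_form B a da.
  split.
  - by move=> z Bz k u v; rewrite /a linw// mulrDr mulrCA.
  - by move=> v; exact: within_continuousM.
  - move=> z u v Bz.
    refine (is_derive_eq (f := fun z => a z v)
      (is_deriveM (is_derive_expN (dh z u Bz)) (dwP z u v Bz)) _).
    by rewrite /da /GRing.scale /=; ring.
  - move=> u v; apply: within_continuousM => //.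
    apply: within_continuousD; first exact: cdw.
    by move=> z; apply: cvgN; apply: within_continuousM; [exact: cT|exact: cw].
have asym z u v : B z -> da z u v = da z v u.
  by move=> Bz; congr (_ * _); have := w_closed u v Bz; lra.
have [F [dF cF]] := poincare r0 a1 asym.
pose b := expR (- h y) * c - F y.
exists (fun z => expR (h z) * (F z + b)); split.
- move=> z v Bz.
  have d1 : is_derive z v (fun z => expR (h z)) (expR (h z) * theta z v).
    exact: (is_derive_post_comp (is_derive_expR _) (dh z v Bz)).
  have d2 : is_derive z v (fun z => F z + b) (a z v + 0).
    exact: (is_deriveD (dF z v Bz) (is_derive_cst b z v)).
  refine (is_derive_eq (f := fun z => expR (h z) * (F z + b)) (is_deriveM d1 d2) _).
  rewrite /GRing.scale /= addr0 /a [X in X + _]mulrA -expRD subrr expR0.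
  by ring.
- apply: within_continuousM => //; apply: within_continuousD => //.
  by move=> z; exact: cvg_cst.
- by rewrite /b addrC subrK mulrA -expRD subrr expR0 mul1r.
Qed.

(** The difference of two solutions solves the homogeneous equation, so [exp(-h) (f - g)] with
    [dh = theta] has zero derivative and is constant on the ball. *)
Lemma twisted_solution_unique f g y z : twisted_solution f ->
  twisted_solution g -> B y -> B z -> f y = g y -> f z = g z.
Proof.
move=> sf sg By Bz fgy.
have [h [dh _]] := poincare r0 theta1 theta_closed.
pose k x := expR (- h x) * (f x - g x).
have dk x v : B x -> is_derive x v k 0.
  move=> Bx; have d2 := is_deriveB (sf x v Bx) (sg x v Bx).
  refine (is_derive_eq (f := k) (is_deriveM (is_derive_expN (dh x v Bx)) d2) _).
  by rewrite /GRing.scale /= -[(f - g) x]/(f x - g x); ring.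
have [t _ /eqP] := mean_value_segment dk By Bz.
rewrite subr_eq0 /k fgy subrr mulr0 mulf_eq0 gt_eqF ?expR_gt0//= subr_eq0.
by move/eqP.
Qed.

(** By uniqueness [f] is the continuous solution already constructed with the same value at the
    centre. This starts the induction on regularity for global solutions. *)
Lemma twisted_solution_continuous f : twisted_solution f ->
  {within B, continuous f}.
Proof.
move=> sf; have Bx0 : B x0 by exact: ballxx.
have [g [sg cg gx]] := twisted_solution_exists (f x0) Bx0.
apply: subspace_eq_continuous cg => y /set_mem By.
exact: (twisted_solution_unique sg sf Bx0 By gx).
Qed.

End twisted_equation.

(** * The twisted equation on a manifold *)

Section smooth_functions.
Variables (R : realType) (V W : normedModType R).
Implicit Types (U : set V) (f g : V -> W).

Lemma Ck_on_subset m U U' f : U' `<=` U -> Ck_on m U f -> Ck_on m U' f.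
Proof.
move=> UU; elim: m f => [|m IH] f /= [cf df]; split => //;
  do ?exact: continuous_subspaceW cf.
move=> v; have [dfv Cf] := df v.
by split => [x /UU|]; [exact: dfv|exact: IH].
Qed.

Lemma Ck_on_eq m U f g : open U -> (forall x, U x -> f x = g x) ->
  Ck_on m U f -> Ck_on m U g.
Proof.
move=> oU; elim: m f g => [|m IH] f g fg /= [cf df]; split => //;
  do ?by apply: subspace_eq_continuous cf => x /set_mem; exact: fg.
move=> v; have [dfv Cf] := df v.
have near_fg x : U x -> \forall y \near x, f y = g y.
  by move=> Ux; apply: filterS (open_nbhs_nbhs (conj oU Ux)) => y; exact: fg.
split => [x Ux|]; first by apply: near_eq_derivable (dfv x Ux); exact: near_fg.
apply: IH Cf => x Ux; apply: near_eq_derive; exact: near_fg.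
Qed.

Lemma Ck_onS m U f : Ck_on m.+1 U f -> Ck_on m U f.
Proof.
elim: m f => [|m IH] f /= [cf df]; split => // v.
by have [dfv Cf] := df v; split => //; exact: IH.
Qed.

Lemma Ck_onD m U f g : open U -> Ck_on m U f -> Ck_on m U g ->
  Ck_on m U (fun x => f x + g x).
Proof.
move=> oU; elim: m f g => [|m IH] f g /= [cf df] [cg dg].
  by split => // x; exact: (cvgD (cf x) (cg x)).
split => [x|v]; first exact: (cvgD (cf x) (cg x)).
have [dfv Cf] := df v; have [dgv Cg] := dg v.
split => [x Ux|]; first exact: (derivableD (dfv x Ux) (dgv x Ux)).
apply: Ck_on_eq oU _ (IH _ _ Cf Cg) => x Ux.
by rewrite -(deriveD (dfv x Ux) (dgv x Ux)).
Qed.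

Lemma Ck_on_cst m U (a : W) : Ck_on m U (cst a).
Proof.
elim: m a => [|m IH] a /=; split => //;
  do ?by apply: continuous_subspaceT => x; exact: cvg_cst.
move=> v; split => [x _|]; first exact: derivable_cst.
have -> : 'D_v (cst a) = cst (0 : W).
  by apply/funext => x; rewrite derive_cst.
exact: IH.
Qed.

End smooth_functions.

Lemma Ck_onM (R : realType) (V : normedModType R) m (U : set V) (f g : V -> R) : open U -> Ck_on m U f -> Ck_on m U g ->
  Ck_on m U (fun x => f x * g x).
Proof.
move=> oU; elim: m f g => [|m IH] f g.
  by move=> /= [cf _] [cg _]; split => //; exact: within_continuousM.
move=> Cf Cg; have Cf' := Ck_onS Cf; have Cg' := Ck_onS Cg.
move: Cf Cg => /= [cf df] [cg dg].
split => [|v]; first exact: within_continuousM.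
have [dfv Df] := df v; have [dgv Dg] := dg v.
split => [x Ux|]; first exact: (derivableM (dfv x Ux) (dgv x Ux)).
apply: (Ck_on_eq (f := fun x => f x * 'D_v g x + g x * 'D_v f x) oU).
  by move=> x Ux; rewrite (deriveM (dfv x Ux) (dgv x Ux)).
apply: Ck_onD => //; exact: IH.
Qed.

(** * Solutions in charts and their globalization *)

Section local_solutions.
Variables (R : realType) (M : smoothManifold R).
Local Notation V := 'rV[R]_(manifold_dim M).
Local Notation phi := (atlas (s := M)).
Local Notation img i := (phi i @` chart_dom (phi i)).

Definition local_form (a : preform M 1) (i : atlas_index M) (y v : V) : R :=
  a i (chart_inv (phi i) y) (fun=> v).

Lemma chart_ball (x : M) (O : set M) : open O -> O x -> exists i r,
  [/\ 0 < r, chart_dom (phi i) x &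
    forall y, ball (phi i x) r y ->
      [/\ chart_dom (phi i) (chart_inv (phi i) y),
          phi i (chart_inv (phi i) y) = y & O (chart_inv (phi i) y)]].
Proof.
move=> oO Ox; have [i ix] := atlas_cover x; exists i.
have iy : img i (phi i x) by exists x.
have nO : \forall y \near phi i x, img i y -> O (chart_inv (phi i) y).
  apply: (within_near (chart_inv_continuous (c := phi i))) => //.
  by rewrite chart_funK.
have nI : \forall y \near phi i x, img i y.
  by apply: open_nbhs_nbhs; split => //; exact: chart_img_open.
have /nbhs_ballP[r /= r0 rP] :
    \forall y \near phi i x, img i y /\ O (chart_inv (phi i) y).
  by apply: filterS2 nI nO => y yi /(_ yi).
exists r; split => // y /rP[[z zi <-] Oz].
by move: Oz; rewrite chart_funK.
Qed.

Lemma open_chart_preimage (i : atlas_index M) (B : set V) : open B ->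
  open (chart_dom (phi i) `&` phi i @^-1` B).
Proof.
move=> oB; rewrite openE => x [ix Bx].
have := within_near (chart_fun_continuous (c := phi i)) ix oB Bx.
apply: filterS2 (open_nbhs_nbhs (conj (chart_dom_open (phi i)) ix)) => y yi.
by move=> /(_ yi).
Qed.

Section one_form.
Variable a : preform M 1.
Hypothesis Oa : Omega a.

Lemma local_form_linear i y : img i y -> scalar (local_form a i y).
Proof.
move=> [z zi <-] k u v; rewrite /local_form chart_funK//.
have E q : (fun=> q) = [eta (fun=> 0 : V) with ord0 |-> q] :> ('I_1 -> V).
  by apply/funext => l /=; rewrite ord1.
by have := Omega_multilinear Oa zi (fun=> 0) ord0 k u v; rewrite -!E.
Qed.

Lemma local_form_smooth i v : smooth_on (img i) (local_form a i ^~ v).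
Proof. exact: (Omega_smooth Oa i (fun=> v)). Qed.

Lemma local_form_C1 i (B : set V) : B `<=` img i ->
  C1_form B (local_form a i) (fun y u v => 'D_u (local_form a i ^~ v) y).
Proof.
move=> Bi; have C2 v := Ck_on_subset Bi (@local_form_smooth i v 2).
split.
- by move=> y /Bi; exact: local_form_linear.
- by move=> v; have [] := C2 v.
- move=> y u v By; have [_ /(_ u)[dv _]] := C2 v.
  exact: derivableP (dv y By).
- by move=> u v; have [_ /(_ u)[_ []]] := C2 v.
Qed.

End one_form.

Definition pair_vec (u v : V) : 'I_2 -> V := fun l => if l == ord0 then u else v.

Lemma ext_d_pair (a : preform M 1) i y u v : img i y ->
  ext_d a i (chart_inv (phi i) y) (pair_vec u v) =
  'D_u (local_form a i ^~ v) y - 'D_v (local_form a i ^~ u) y.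
Proof.
move=> [z zi <-]; rewrite chart_funK// /ext_d asboolT// big_ord_recl big_ord1.
rewrite expr0 mul1r expr1 mulN1r.
have E0 : (fun l : 'I_1 => pair_vec u v (lift ord0 l)) = (fun=> v).
  by apply/funext => l; rewrite (ord1 l).
have E1 : (fun l : 'I_1 => pair_vec u v (lift (lift ord0 ord0) l)) = (fun=> u).
  by apply/funext => l; rewrite (ord1 l).
by rewrite E0 E1.
Qed.

Lemma wedge1_pair (a b : preform M 1) i y u v :
  wedge1 a b i (chart_inv (phi i) y) (pair_vec u v) =
  local_form a i y u * local_form b i y v - local_form a i y v * local_form b i y u.
Proof.
rewrite /wedge1 big_ord_recl big_ord1 expr0 mul1r expr1 mulN1r.
have E0 : (fun l : 'I_1 => pair_vec u v (lift ord0 l)) = (fun=> v).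
  by apply/funext => l; rewrite (ord1 l).
have E1 : (fun l : 'I_1 => pair_vec u v (lift (lift ord0 ord0) l)) = (fun=> u).
  by apply/funext => l; rewrite (ord1 l).
by rewrite E0 E1.
Qed.

Section solutions.
Variables (theta w : preform M 1).
Hypothesis Otheta : Omega theta.
Hypothesis Ow : Omega w.
Hypothesis theta_closed : ext_d theta = 0.
Hypothesis w_closed : twisted_d theta w = 0.

(* [d f = theta f + w] on [U], in all charts *)
Definition local_solution (U : set M) (f : M -> R) : Prop :=
  forall z i v, U z -> chart_dom (phi i) z ->
    is_derive (phi i z) v (f \o chart_inv (phi i))
      (theta i z (fun=> v) * f z + w i z (fun=> v)).

Let closedE i y u v : img i y ->
  'D_u (local_form theta i ^~ v) y = 'D_v (local_form theta i ^~ u) y.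
Proof.
move=> iy; apply/eqP; rewrite -subr_eq0 -ext_d_pair//.
by rewrite theta_closed.
Qed.

Let w_closedE i y u v : img i y ->
  'D_u (local_form w i ^~ v) y - 'D_v (local_form w i ^~ u) y =
  local_form theta i y u * local_form w i y v -
  local_form theta i y v * local_form w i y u.
Proof.
move=> iy; rewrite -ext_d_pair// -wedge1_pair; apply/eqP; rewrite -subr_eq0; apply/eqP.
exact: (congr1 (fun b : preform M 2 => b i (chart_inv (phi i) y) (pair_vec u v)) w_closed).
Qed.

(** [local_solution] asks for the equation in every chart, while [g] solves it in chart [i]. The
    chain rule and the compatibility of forms transfer it to any other chart [j]. *)
Lemma local_solution_chart i (x0 : V) r (g : V -> R) :
  ball x0 r `<=` img i ->
  twisted_solution x0 r (local_form theta i) (local_form w i) g ->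
  {within ball x0 r, continuous g} ->
  local_solution (chart_dom (phi i) `&` phi i @^-1` ball x0 r) (g \o phi i).
Proof.
move=> Bi sg cg z j v [zi Bz] zj.
have [linT cT _ _] := local_form_C1 Otheta Bi.
have [linw cw _ _] := local_form_C1 Ow Bi.
have trans_d : derivable (transition (phi j) (phi i)) (phi j z) v.
  have [_ /(_ v)[+ _]] := atlas_smooth j i 1.
  by apply; exists z.
apply: is_derive_line0.
(* A coordinate line of chart [j] read in chart [i]. Its velocity at 0 is [change_coord j i z v],
   the vector that occurs in [Omega_compatible]. *)
pose c (s : R) := transition (phi j) (phi i) (phi j z + s *: v).
have c0 : c 0 = phi i z by rewrite /c scale0r addr0 /transition chart_funK.
have dc : is_derive (0 : R) (1 : R) c (change_coord j i z v).
  apply: is_derive_line; rewrite scale0r addr0; exact: derivableP.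
pose L y v := local_form theta i y v * g y + local_form w i y v.
have linL y : ball x0 r y -> scalar (L y).
  move=> By k p q; rewrite /L (linT y By) (linw y By).
  by rewrite mulrDl -!mulrA mulrDr addrACA.
have contL y q : ball x0 r y -> {for y, continuous (L ^~ q)}.
  move: y; apply/within_ball_continuous; apply: within_continuousD => //.
  exact: within_continuousM.
have := @is_derive_curve R _ g L x0 r sg linL contL c (change_coord j i z v) 0.
rewrite c0 => /(_ Bz dc) dgc; apply: (is_derive_eq (f := g \o c) dgc).
rewrite /L /local_form chart_funK//.
by rewrite -!(Omega_compatible _ _ zj zi).
Qed.

(** Coordinate balls are trivializing: straight segments of the chart join their points, and
    existence and uniqueness are those of the twisted equation on a ball. *)
Lemma local_solution_local_system : local_system local_solution.
Proof.
split; first by move=> U U' f UU sf z i v /UU; exact: sf.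
move=> x O oO Ox; have [i [r [r0 ix rP]]] := chart_ball oO Ox.
pose U := chart_dom (phi i) `&` phi i @^-1` ball (phi i x) r.
have Bi : ball (phi i x) r `<=` img i.
  by move=> y /rP[yi yE _]; exists (chart_inv (phi i) y).
have oU : open U by apply: open_chart_preimage; exact: ball_open.
have T1 := local_form_C1 Otheta Bi; have w1 := local_form_C1 Ow Bi.
have Tc y u v (By : ball (phi i x) r y) := closedE u v (Bi y By).
have wc y u v (By : ball (phi i x) r y) := w_closedE u v (Bi y By).
have UE z : U z -> chart_inv (phi i) (phi i z) = z.
  by move=> [zi _]; rewrite chart_funK.
exists U; split; last first.
- by move=> z [zi Bz]; have [_ _] := rP _ Bz; rewrite chart_funK.
- by split => //; exact: ballxx.
split => //.
- move=> y z [yi By] [zi Bz].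
  have B_seg t : unit_interval t -> ball (phi i x) r (phi i y + t *: (phi i z - phi i y)).
    by move=> t01; exact: ball_segment.
  exists (fun t => chart_inv (phi i) (phi i y + t *: (phi i z - phi i y))); split.
  + refine (Defs.within_continuous_comp (f := fun t : R => phi i y + t *: (phi i z - phi i y))
      (chart_inv_continuous (c := phi i)) _ _).
      by move=> t It; apply: Bi; exact: B_seg.
    apply: continuous_subspaceT => t; apply: cvgD; first exact: cvg_cst.
    by apply: cvgZ; [exact: cvg_id|exact: cvg_cst].
  + by rewrite scale0r addr0 chart_funK.
  + by rewrite scale1r addrC subrK chart_funK.
  + by move=> t /B_seg Bt; have [ti tE _] := rP _ Bt; split => //=; rewrite tE.
- move=> y c [yi By].
  have [g [sg cg gy]] := twisted_solution_exists r0 T1 w1 Tc wc c By.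
  by exists (g \o phi i) => //; exact: local_solution_chart.
- move=> f g y z sf sg Uy Uz fg.
  have tw h : local_solution U h ->
      twisted_solution (phi i x) r (local_form theta i) (local_form w i)
        (h \o chart_inv (phi i)).
    move=> sh q v Bq; have [qi qE _] := rP _ Bq.
    have Uq : U (chart_inv (phi i) q) by split => //=; rewrite qE.
    by have := sh _ i v Uq qi; rewrite qE.
  have := twisted_solution_unique r0 T1 Tc (tw f sf) (tw g sg) Uy.2 Uz.2.
  by rewrite /= !UE//; apply.
Qed.

Section global_solution.
Variable F : M -> R.
Hypothesis locF : forall x, exists U f,
  [/\ open U, U x, local_solution U f & forall y, U y -> F y = f y].

Lemma global_solution_derive i z v : chart_dom (phi i) z ->
  is_derive (phi i z) v (F \o chart_inv (phi i))
    (theta i z (fun=> v) * F z + w i z (fun=> v)).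
Proof.
move=> zi; have [U [f [oU Uz sf Ff]]] := locF z.
have iz : img i (phi i z) by exists z.
rewrite Ff//; apply: near_eq_is_derive (sf z i v Uz zi).
have nI : \forall y \near phi i z, img i y.
  by apply: open_nbhs_nbhs; split => //; exact: chart_img_open.
have nU : \forall y \near phi i z, img i y -> U (chart_inv (phi i) y).
  apply: (within_near (chart_inv_continuous (c := phi i))) => //.
  by rewrite chart_funK.
by apply: filterS2 nI nU => y yi /(_ yi) Uy /=; rewrite Ff.
Qed.

Let F_derive i y v : img i y -> is_derive y v (F \o chart_inv (phi i))
  (local_form theta i y v * (F \o chart_inv (phi i)) y + local_form w i y v).
Proof.
move=> [z zi <-]; rewrite /local_form /= chart_funK//.
exact: global_solution_derive.
Qed.

(** Bootstrap: the derivative of [F] along [v] is [theta_v F + w_v] in the chart, so it is as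
    regular as [F], and [F] gains one order at each step. The start is continuity, which holds for
    every solution on a ball. *)
Lemma global_solution_smooth i :
  smooth_on (img i) (F \o chart_inv (phi i) : V -> R).
Proof.
have oI : open (img i) by exact: chart_img_open.
have cF : {within img i, continuous (F \o chart_inv (phi i))}.
  rewrite continuous_open_subspace// => y; rewrite inE => yi.
  have /nbhs_ballP[r /= r0 Br] : \forall y' \near y, img i y'.
    exact: open_nbhs_nbhs.
  have T1 := local_form_C1 Otheta Br; have w1 := local_form_C1 Ow Br.
  have Tc y' u v (By : ball y r y') := closedE u v (Br y' By).
  have wc y' u v (By : ball y r y') := w_closedE u v (Br y' By).
  have sF : twisted_solution y r (local_form theta i) (local_form w i)
      (F \o chart_inv (phi i)).
    by move=> y' v /Br; exact: F_derive.
  have := twisted_solution_continuous r0 T1 w1 Tc wc sF.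
  by move=> /within_ball_continuous; apply; exact: ballxx.
elim=> [|m IH] //=; split => // v; split => [y yi|].
  by have [] := F_derive v yi.
apply: (Ck_on_eq (f := fun y => local_form theta i y v * (F \o chart_inv (phi i)) y
  + local_form w i y v) oI).
  by move=> y yi; have [_ ->] := F_derive v yi.
apply: Ck_onD => //; last exact: local_form_smooth.
by apply: Ck_onM => //; exact: local_form_smooth.
Qed.

Definition function_form : preform M 0 := fun i x _ =>
  if `[< chart_dom (phi i) x >] then F x else 0.

Let function_formE i v y : img i y ->
  (F \o chart_inv (phi i)) y = function_form i (chart_inv (phi i) y) v.
Proof. by move=> [z zi <-]; rewrite /function_form /= chart_funK// asboolT. Qed.

Lemma Omega_function_form : Omega function_form.
Proof.
split.
- by move=> i x v nix; rewrite /function_form asboolF.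
- by move=> i x _ v [].
- by move=> i x _ v [].
- by move=> i j x v ix jx; rewrite /function_form !asboolT.
- move=> i v m; apply: Ck_on_eq (@global_solution_smooth i m).
    exact: chart_img_open.
  exact: function_formE.
Qed.

Lemma ext_d_function_form : ext_d function_form = wedge1 theta function_form + w.
Proof.
apply/funext => i; apply/funext => x; apply/funext => v.
rewrite -[RHS]/(wedge1 theta function_form i x v + w i x v) /ext_d /wedge1.
rewrite !big_ord1 expr0 !mul1r.
have vE : (fun=> v ord0) = v by apply/funext => l; rewrite (ord1 l).
case: asboolP => ix; last first.
  by rewrite (Omega_out Otheta _ ix) (Omega_out Ow _ ix) mul0r addr0.
have ixy : img i (phi i x) by exists x.
have := global_solution_derive (v ord0) ix.
rewrite vE {2}/function_form asboolT// => dF.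
have nI : \forall y \near phi i x, img i y.
  by apply: open_nbhs_nbhs; split => //; exact: chart_img_open.
suff : is_derive (phi i x) (v ord0) (fun y =>
    function_form i (chart_inv (phi i) y) (fun l => v (lift ord0 l)))
    (theta i x v * F x + w i x v) by case.
by apply: near_eq_is_derive dF; apply: filterS nI => y; exact: function_formE.
Qed.

End global_solution.

End solutions.
End local_solutions.

(** * Cohomology *)

Section form_operations.
Variables (R : realType) (M : smoothManifold R).
Local Notation phi := (atlas (s := M)).

(** One verification for sums and differences, with [c = 1] and [c = -1]. *)
Lemma Omega_comb k (a b : preform M k) (c : R) : Omega a -> Omega b ->
  Omega (fun i x v => a i x v + c * b i x v : R).
Proof.
move=> Oa Ob; split.
- by move=> i x v ix; rewrite (Omega_out Oa v ix) (Omega_out Ob v ix) mulr0 addr0.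
- move=> i x ix v j t p q.
  rewrite (Omega_multilinear Oa ix v j) (Omega_multilinear Ob ix v j).
  by rewrite mulrDr addrACA [in RHS]mulrDr [c * (t * _)]mulrCA.
- move=> i x ix v p q pq vpq.
  by rewrite (Omega_alternating Oa ix pq vpq) (Omega_alternating Ob ix pq vpq)
    mulr0 addr0.
- move=> i j x v ix jx.
  by rewrite (Omega_compatible Oa v ix jx) (Omega_compatible Ob v ix jx).
- move=> i v m; have oI : open (phi i @` chart_dom (phi i)).
    exact: chart_img_open.
  apply: (@Ck_onD _ _ _ m _ _ _ oI); first exact: (Omega_smooth Oa i v m).
  apply: (@Ck_onM _ _ m _ (cst c) _ oI); first exact: Ck_on_cst.
  exact: (Omega_smooth Ob i v m).
Qed.

Lemma OmegaD k (a b : preform M k) : Omega a -> Omega b -> Omega (a + b).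
Proof.
move=> Oa Ob; have := Omega_comb 1 Oa Ob.
congr Omega; apply/funext => i; apply/funext => x; apply/funext => v.
by rewrite mul1r.
Qed.

Lemma OmegaB k (a b : preform M k) : Omega a -> Omega b -> Omega (a - b).
Proof.
move=> Oa Ob; have := Omega_comb (-1) Oa Ob.
congr Omega; apply/funext => i; apply/funext => x; apply/funext => v.
by rewrite mulN1r.
Qed.

Lemma Omega0 k : Omega (0 : preform M k).
Proof.
split => //.
- by move=> i x _ v j t p q; rewrite /= mulr0 addr0.
- by move=> i v m; exact: Ck_on_cst.
Qed.

Lemma ext_dD k (a b : preform M k) : Omega a -> Omega b ->
  ext_d (a + b) = ext_d a + ext_d b.
Proof.
move=> Oa Ob; apply/funext => i; apply/funext => x; apply/funext => v.
rewrite -[RHS]/(ext_d a i x v + ext_d b i x v) /ext_d.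
case: asboolP => ix; last by rewrite addr0.
have ixy : (phi i @` chart_dom (phi i)) (phi i x) by exists x.
rewrite -big_split /=; apply: eq_bigr => j _; rewrite -mulrDr; congr (_ * _).
have [_ /(_ (v j))[da _]] := Omega_smooth Oa i (fun l => v (lift j l)) 1.
have [_ /(_ (v j))[db _]] := Omega_smooth Ob i (fun l => v (lift j l)) 1.
by rewrite -(deriveD (da _ ixy) (db _ ixy)).
Qed.

Lemma wedge1Dr (theta : preform M 1) k (a b : preform M k) :
  wedge1 theta (a + b) = wedge1 theta a + wedge1 theta b.
Proof.
apply/funext => i; apply/funext => x; apply/funext => v.
rewrite -[RHS]/(wedge1 theta a i x v + wedge1 theta b i x v) /wedge1.
by rewrite -big_split /=; apply: eq_bigr => j _; rewrite -mulrDr -mulrDr.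
Qed.

Lemma wedge1r0 (theta : preform M 1) k : wedge1 theta (0 : preform M k) = 0.
Proof. by apply: (@addrI _ (wedge1 theta 0)); rewrite -wedge1Dr !addr0. Qed.

Lemma wedge1l0 k (a : preform M k) : wedge1 0 a = 0.
Proof.
apply/funext => i; apply/funext => x; apply/funext => v.
by rewrite /wedge1 big1// => j _; rewrite mul0r mulr0.
Qed.

Lemma ext_d0 k : ext_d (0 : preform M k) = 0.
Proof.
apply: (@addrI _ (ext_d 0)).
by rewrite -ext_dD; rewrite ?addr0//; exact: Omega0.
Qed.

Lemma twisted_dD (theta : preform M 1) k (a b : preform M k) :
  Omega a -> Omega b ->
  twisted_d theta (a + b) = twisted_d theta a + twisted_d theta b.
Proof.
by move=> Oa Ob; rewrite /twisted_d ext_dD// wedge1Dr opprD addrACA.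
Qed.

Lemma twisted_d0 (theta : preform M 1) k : twisted_d theta (0 : preform M k) = 0.
Proof. by rewrite /twisted_d ext_d0 wedge1r0 subr0. Qed.

(** Translation by [a] permutes the primitives, so both cosets are the set of all coboundaries. Only
    additivity of [D] enters, which lets the lemma serve for [ext_d] and for [twisted_d theta]. *)
Lemma cohomology_class_exact (D : forall k, preform M k -> preform M k.+1) k
    (a : preform M k) :
  (forall b c : preform M k, Omega b -> Omega c -> D k (b + c) = D k b + D k c) ->
  Omega a -> cohomology_class D (D k a) = cohomology_class D 0.
Proof.
move=> DD Oa; apply/seteqP; split => [_ [_ [b Ob <-] <-]|_ [_ [b Ob <-] <-]].
  exists (D k (a + b)); first by exists (a + b) => //; exact: OmegaD.
  by rewrite add0r DD.
exists (D k (b - a)); first by exists (b - a) => //; exact: OmegaB.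
by rewrite add0r -(DD _ _ Oa (OmegaB Ob Oa)) [a + _]addrC subrK.
Qed.

End form_operations.

(** * The affine representation of the fundamental group *)

Section monodromy_representation.
Variables (R : realType) (M : smoothManifold R) (p : M) (theta w : preform M 1).
Hypothesis Otheta : Omega theta.
Hypothesis Ow : Omega w.
Hypothesis theta_closed : ext_d theta = 0.
Hypothesis w_closed : twisted_d theta w = 0.

Let O0 : Omega (0 : preform M 1) := Omega0 M 1.

(** The systems [sys], [hom_sys] and [add_sys] belong to [df = theta f + w], [df = theta f] and
    [df = theta]. *)
Let sys := local_solution_local_system Otheta Ow theta_closed w_closed.
Let hom_sys := local_solution_local_system Otheta O0 theta_closed (twisted_d0 theta 1).
Lemma twisted_d_zero_form : twisted_d 0 theta = 0.
Proof. by rewrite /twisted_d theta_closed wedge1l0 subr0. Qed.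
Let add_sys := local_solution_local_system O0 Otheta (ext_d0 M 1) twisted_d_zero_form.

Lemma local_solution_expR U f : local_solution 0 theta U f ->
  local_solution theta 0 U (fun x => expR (f x)).
Proof.
move=> sf z i v Uz zi.
have := is_derive_post_comp (is_derive_expR _) (sf z i v Uz zi).
move=> D; apply: (is_derive_eq (f := (fun x => expR (f x)) \o chart_inv (atlas i)) D).
rewrite /= chart_funK//.
have z0 q : (0 : preform M 1) i z q = 0 by [].
by rewrite !z0 mul0r add0r addr0 mulrC.
Qed.

Lemma local_solutionD U f g a : local_solution theta 0 U f ->
  local_solution theta w U g -> local_solution theta w U (fun x => f x * a + g x).
Proof.
move=> sf sg z i v Uz zi.
have D := is_deriveD (is_deriveM (sf z i v Uz zi) (is_derive_cst a _ v))
  (sg z i v Uz zi).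
apply: (is_derive_eq (f := (fun x => f x * a + g x) \o chart_inv (atlas i)) D).
have z0 q : (0 : preform M 1) i z q = 0 by [].
by rewrite /GRing.scale /= z0; ring.
Qed.

Let rho (x : pi1 R p) := monodromy (local_solution theta 0) x 1.
Let c (x : pi1 R p) := monodromy (local_solution theta w) x 0.
Let chi (x : pi1 R p) := monodromy (local_solution 0 theta) x 0.

(** Superposition: [a] times the homogeneous continuation starting at 1, plus the inhomogeneous one
    starting at 0, continues a twisted solution from the value [a]. *)
Lemma monodromy_affine x a : monodromy (local_solution theta w) x a = rho x * a + c x.
Proof.
elim/pi1_classW: x => f; apply/esym/(monodromyP sys).
have /(monodromyP hom_sys) [u [lu u0 u1]] := erefl (rho (pi1_class f)).
have /(monodromyP sys) [v [lv v0 v1]] := erefl (c (pi1_class f)).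
exists (fun t => u t * a + v t); split; last 2 first.
- by rewrite u0 v0 mul1r addr0.
- by rewrite u1 v1.
apply: (continuation_map2 (op := fun b d => b * a + d) hom_sys sys) lu lv.
by move=> U g h _; exact: local_solutionD.
Qed.

(** The exponential of a continued primitive of [theta] is a continuation for the homogeneous
    equation, and it starts at [exp 0 = 1]. *)
Lemma monodromy_exp x : rho x = expR (chi x).
Proof.
elim/pi1_classW: x => f; apply/esym/(monodromyP hom_sys).
have /(monodromyP add_sys) [u [lu u0 u1]] := erefl (chi (pi1_class f)).
exists (fun t => expR (u t)); split; last 2 first.
- by rewrite u0 expR0.
- by rewrite u1.
apply: (continuation_map2 (op := fun b _ => expR b) add_sys add_sys _ lu lu).
by move=> U g h _ sg _; exact: local_solution_expR.
Qed.

Lemma twisted_exact : connected [set: M] -> nilpotent_group (pi1 R p) ->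
  deRham_class theta <> deRham_class 0 ->
  exists2 f : preform M 0, Omega f & twisted_d theta f = w.
Proof.
move=> cM nil theta_nontrivial.
have [[g rg1]|rho1] := pselect (exists g, rho g != 1); last first.
  (* With [rho] trivial, all periods [chi] vanish by injectivity of the exponential. The value 0 is
     then fixed by the monodromy of [df = theta], so [theta] has a global primitive. *)
  exfalso; apply: theta_nontrivial.
  have chi0 (x : pi1 R p) : monodromy (local_solution 0 theta) x 0 = 0.
    rewrite -[LHS]/(chi x); apply: expR_inj; rewrite expR0 -monodromy_exp; apply/eqP.
    by apply: contrapT => /negP rx; apply: rho1; exists x.
  have [F locF] := global_section add_sys cM chi0.
  have Of := Omega_function_form O0 Otheta (ext_d0 M 1) twisted_d_zero_form locF.
  have df := ext_d_function_form O0 Otheta locF.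
  rewrite wedge1l0 add0r in df; rewrite /deRham_class -df.
  by apply: cohomology_class_exact => // b d; exact: ext_dD.
have [||a afix] := @nilpotent_affine_fixpoint R (pi1 R p) rho c g _ _ nil rg1.
- by move=> x y a; rewrite -!monodromy_affine (monodromyM sys).
- by move=> a; rewrite -monodromy_affine (monodromy1 sys).
have fixa (x : pi1 R p) : monodromy (local_solution theta w) x a = a.
  by rewrite monodromy_affine afix.
have [F locF] := global_section sys cM fixa.
exists (function_form F).
  exact: (Omega_function_form Otheta Ow theta_closed w_closed locF).
by rewrite /twisted_d (ext_d_function_form Otheta Ow locF) addrAC subrr add0r.
Qed.

End monodromy_representation.

(** Cohomology is a set of cosets, so its vanishing says that the coset of 0 is its only element:
    every twisted cocycle is exact, and 0 is a cocycle. *)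
Theorem corollary3p1 (R : realType) (M : smoothManifold R) (p : M)
  (M_connected : connected [set: M])
  (pi1_nilpotent : nilpotent_group (pi1 R p))
  (theta : preform M 1) (theta_closed : closed_form theta)
  (theta_nontrivial : deRham_class theta <> deRham_class 0) :
  twisted_cohomology theta 1 = [set twisted_class theta 0].
Proof.
have [Otheta dtheta] := theta_closed.
apply/seteqP; split => [_ [w [Ow dw] <-]|_ ->].
  have [f Of <-] := twisted_exact Otheta Ow dtheta dw M_connected pi1_nilpotent
    theta_nontrivial.
  by apply: cohomology_class_exact => // a b; exact: twisted_dD.
exists 0 => //; split; first exact: Omega0.
exact: twisted_d0.
Qed.
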